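(* Assume the Hardy-Littlewood Conjecture. Let $\alpha$ be an integer with $\alpha\equiv 1\pmod 4$ and let $D$ be a nonzero integer with $2\parallel D$ or $8\parallel D$. Then $$\mathrm{dens}_D(2\alpha)=\mathrm{dens}_D(-2\alpha)=\frac14 .$$
   Context: $2^k\parallel D$ means $2^k\mid D$ and $2^{k+1}\nmid D$. For a nonzero integer $D$, $E_D$ is the elliptic curve $y^2=x^3+Dx$, and for a prime $p\nmid 2D$, $a_p(E_D)=1+p-\#\tilde E_D(\mathbb{F}_p)$. For a nonzero integer $m$ put $Q(m,N)=\{p \text{ prime}: p=m^2+x^2\le N \text{ for some } x\in\mathbb{Z}\}$ and $$\mathrm{dens}_D(2m)=\lim_{N\to\infty}\frac{\#\{p\in Q(m,N): p\nmid 2D,\ a_p(E_D)=2m\}}{\#Q(m,N)}$$ (denoted $a_p(2m)$ in the paper); the claim includes that the limits exist. Hardy-Littlewood Conjecture: for all integers $a,b,c$ with $a>0$, $\gcd(a,b,c)=1$, $a+b$ and $c$ not both even, and $\Delta=b^2-4ac$ not a perfect square, the number $P(n)$ of primes less than $n$ of the form $ax^2+bx+c$ (with $x$ a nonnegative integer) satisfies $P(n)\sim\delta(a,b,c)\frac{\sqrt{n}}{\log n}$ as $n\to\infty$, where $$\delta(a,b,c)=\frac{\gcd(2,a+b)}{\sqrt{a}}\prod_{p\mid a,\ p\mid b,\ p>2}\frac{p}{p-1}\ \prod_{p\nmid a,\ p>2}\left(1-\frac{\left(\frac{\Delta}{p}\right)}{p-1}\right),$$ the products being over primes (the second taken in increasing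 order of $p$) and $\left(\frac{\cdot}{p}\right)$ being the Legendre symbol. *)

(* Defs.v *)
From HB Require Import structures.
From mathcomp Require Import all_boot all_order all_algebra.
From mathcomp Require Import all_classical all_reals all_analysis.

Set Implicit Arguments.
Unset Strict Implicit.
Unset Printing Implicit Defensive.

Import Order.TTheory GRing.Theory Num.Theory.
Import numFieldNormedType.Exports.

Local Open Scope ring_scope.

(* [exactly_divides q k D] is q^k || D. *)
Definition exactly_divides (q : int) (k : nat) (D : int) : bool :=
  (q ^+ k %| D)%Z && ~~ (q ^+ k.+1 %| D)%Z.

(* The definitions below with values in or over 'F_p are only meaningful for
   p prime, which is always imposed where they are used. *)

Definition legendre (d : int) (p : nat) : int :=
  if (p%:Z %| d)%Z then 0
  else if [exists x : 'F_p, x ^+ 2 == d%:~R] then 1 else -1.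

(* Projective points over 'F_p of the Weierstrass cubic y^2 = x^3 + D x:
   [None] is its single point at infinity. *)
Definition curve_points (D : int) (p : nat) : pred (option ('F_p * 'F_p)) :=
  fun P => match P with
           | None => true
           | Some (x, y) => y ^+ 2 == x ^+ 3 + D%:~R * x
           end.
Arguments curve_points : clear implicits.

Definition trace_frob (D : int) (p : nat) : int :=
  1 + p%:Z - #|curve_points D p|%:Z.

Definition inQ (m : int) (p : nat) : bool :=
  prime p && `[< exists x : int, p%:Z = m ^+ 2 + x ^+ 2 >].

Definition cardQ (m : int) (N : nat) : nat :=
  #|[pred p : 'I_N.+1 | inQ m p]|.

Definition cardQ_trace (D m : int) (N : nat) : nat :=
  #|[pred p : 'I_N.+1 | [&& inQ m p, ~~ (p%:Z %| 2 * D)%Z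
                          & trace_frob D p == 2 * m]]|.

(* The sequence in N whose limit is dens_D(2m); note that its parameter is m,
   not the trace value 2m. *)
Definition dens_seq (R : realType) (D m : int) : nat -> R :=
  fun N => (cardQ_trace D m N)%:R / (cardQ m N)%:R.

(* Number of primes p < n of the form a x^2 + b x + c with x >= 0 (each prime
   is counted once, however many x represent it). *)
Definition quad_primes (a b c : int) (n : nat) : nat :=
  #|[pred p : 'I_n | prime p &&
      `[< exists x : nat, (p : nat)%:Z = a * x%:Z ^+ 2 + b * x%:Z + c >]]|.

Definition discr (a b c : int) : int := b ^+ 2 - 4 * a * c.

(* The primes dividing a are at most `|a| when a != 0, so this is the full
   product over the odd primes dividing both a and b. *)
Definition HL_common_factor (R : realType) (a b : int) : R :=
  \prod_(3 <= p < `|a|%N.+1 | [&& prime p, (p%:Z %| a)%Z & (p%:Z %| b)%Z])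
    (p%:R / (p%:R - 1)).

Definition HL_partial_product (R : realType) (a b c : int) : nat -> R :=
  fun n => \prod_(3 <= p < n | prime p && ~~ (p%:Z %| a)%Z)
             (1 - (legendre (discr a b c) p)%:~R / (p%:R - 1)).

(* The infinite product converges only conditionally, hence the limit of the
   partial products taken in increasing order of p. *)
Definition HL_delta (R : realType) (a b c : int) : R :=
  (gcdz 2 (a + b))%:~R / Num.sqrt a%:~R * HL_common_factor R a b *
  limn (HL_partial_product R a b c).

Definition Hardy_Littlewood (R : realType) : Prop :=
  forall a b c : int,
    0 < a ->
    gcdz (gcdz a b) c = 1 ->
    ~ ((2 %| a + b)%Z /\ (2 %| c)%Z) ->
    ~ (exists k : int, discr a b c = k ^+ 2) ->
    (fun n : nat => (quad_primes a b c n)%:R : R) ~_(\oo%classic)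
    (fun n : nat => HL_delta R a b c * (Num.sqrt n%:R / ln n%:R)).

(* Main.v *)
Require Import Defs.
From mathcomp Require Import all_boot all_order all_algebra.
From mathcomp Require Import all_solvable all_field.
From mathcomp Require Import zify ring lra.
From mathcomp Require Import all_classical all_reals all_analysis.

(** Let [p = alpha ^ 2 + x ^ 2] be an odd prime with [alpha] congruent to 1
    modulo 4, so that [x] is even, and let [f = x / alpha], a square root of -1
    modulo [p]. Counting the points of [y ^ 2 = x ^ 3 + D x] with the Jacobi sum
    of the quartic and the quadratic character, which is [alpha + i x] up to an
    explicit sign ([jacobi_eq]), shows that the trace of Frobenius is [2 alpha],
    [2 x], [- 2 alpha] or [- 2 x] according as the quartic symbol
    [D ^ ((p - 1) / 4)] is 1, [f], -1 or [- f] ([trace_frob_qsym]). Since [x] is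
    even and [alpha] odd, the trace is [2 alpha] or [- 2 alpha] exactly when the
    symbol is 1 or -1, and it remains to see how the symbol varies with [x].

    Write [D = 2 ^ k * D'] with [D'] odd and [k] equal to 1 or 3. The rational
    case of quartic reciprocity says that the symbol of an odd prime [q] depends
    only on [x] modulo [q], up to a power of the symbol of -1; the proof raises
    the quartic Gauss sum to the power [q] in characteristic [q]
    ([qsym_prime_shift]). The symbol of 2 is [f ^ (x / 2)], by an argument of
    Dirichlet using only quadratic symbols ([qsym2]). Hence the symbol of [D] is
    determined by [x] modulo [M = 8 |D'|], and because [k] is odd, replacing [x]
    by [x + 2 |D'|] multiplies it by a primitive fourth root of unity
    ([qsym_shift]). So each of the four values is taken on exactly a quarter of
    the residue classes modulo [M] that are not excluded by a common factor
    ([card_admissible]).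

    The primes belonging to the class of [r] are those represented by the
    polynomial [(M y + r) ^ 2 + alpha ^ 2], whose discriminant
    [- (2 M alpha) ^ 2] does not involve [r]. The Hardy-Littlewood conjecture
    therefore attributes the same constant to all these classes
    ([quad_primes_class]), and the density of a quarter of them is 1 / 4.

    This last step requires the constant to be nonzero, that is, the conditionally
    convergent product of the [1 - chi p / (p - 1)], with [chi] the nontrivial
    character modulo 4, to converge to a nonzero limit. This is a theorem of
    Mertens ([euler_product_cvg]): decomposing [ln m] over the prime powers
    dividing [m] in the sums of [chi m * ln m / m] bounds the sums of
    [chi p * ln p / p], and summation by parts against [1 / ln p] gives the
    convergence. *)

Import Order.TTheory GRing.Theory Num.Theory.
Import numFieldNormedType.Exports.

Set Implicit Arguments.
Unset Strict Implicit.
Unset Printing Implicit Defensive.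

Local Open Scope ring_scope.

(** * Gauss and Jacobi sums over a finite field *)

Section CharacterSums.

Variables (F : finFieldType) (K : fieldType).

Definition mulchar (chi : F -> K) : Prop :=
  [/\ chi 0 = 0, chi 1 = 1 & {morph chi : x y / x * y}].

Definition addchar (psi : F -> K) : Prop :=
  [/\ psi 0 = 1, {morph psi : x y / x + y >-> x * y} & \sum_t psi t = 0].

Definition gauss_sum (psi chi : F -> K) : K := \sum_t chi t * psi t.

Definition jacobi_sum (chi1 chi2 : F -> K) : K := \sum_t chi1 t * chi2 (1 - t).

Lemma mulchar_neq0 chi x : mulchar chi -> x != 0 -> chi x != 0.
Proof.
case=> _ chi1 chiM x0; apply/eqP=> cx0; have := chiM x x^-1.
by rewrite divff // chi1 cx0 mul0r => /eqP; rewrite oner_eq0.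
Qed.

Lemma mulcharMf chi1 chi2 :
  mulchar chi1 -> mulchar chi2 -> mulchar (fun t => chi1 t * chi2 t).
Proof.
move=> [a0 a1 aM] [b0 b1 bM]; split; rewrite ?a0 ?mul0r ?a1 ?b1 ?mulr1 //.
by move=> x y; rewrite aM bM mulrACA.
Qed.

Lemma sum_scale (h : F -> K) c : c != 0 -> \sum_t h (c * t) = \sum_t h t.
Proof.
move=> c0; symmetry; rewrite (reindex_inj (mulfI c0)) /=.
exact: eq_bigr.
Qed.

(** Multiplying the variable by an element where the character is not 1 shows
    that the sum equals a multiple of itself different from 1. *)
Lemma sum_mulchar chi b : mulchar chi -> b != 0 -> chi b != 1 ->
  \sum_t chi t = 0.
Proof.
move=> [_ _ chiM] b0 cb1; apply/eqP.
have : (chi b - 1) * \sum_t chi t == 0.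
  rewrite mulrBl mul1r subr_eq0 mulr_sumr -(sum_scale chi b0).
  by apply/eqP/eq_bigr => t _; rewrite chiM.
by rewrite mulf_eq0 subr_eq0 (negPf cb1).
Qed.

Lemma gauss_sum_scale psi chi c : mulchar chi -> c != 0 ->
  \sum_t chi t * psi (c * t) = (chi c)^-1 * gauss_sum psi chi.
Proof.
move=> mchi c0; have cc0 := mulchar_neq0 mchi c0; apply: (mulfI cc0).
case: (mchi) => _ _ chiM; rewrite mulVKf // mulr_sumr /gauss_sum.
rewrite -(sum_scale (fun t => chi t * psi t) c0).
by apply: eq_bigr => t _; rewrite chiM mulrA.
Qed.

(** The product of two Gauss sums, sorted by the value [u] of the sum of the two
    variables: for [u] nonzero the inner sum is a Jacobi sum by homogeneity. *)
Lemma gauss_sumM psi chi1 chi2 : addchar psi -> mulchar chi1 -> mulchar chi2 ->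
  gauss_sum psi chi1 * gauss_sum psi chi2 =
  chi2 (-1) * \sum_t chi1 t * chi2 t +
  jacobi_sum chi1 chi2 * \sum_(u | u != 0) chi1 u * chi2 u * psi u.
Proof.
move=> [psi0 psiD _] m1 m2.
case: (m1) => _ _ c1M; case: (m2) => c20 _ c2M.
rewrite /gauss_sum mulr_suml.
transitivity (\sum_s \sum_u chi1 s * chi2 (u - s) * psi u).
  apply: eq_bigr => s _; rewrite mulr_sumr.
  rewrite [RHS](reindex_inj (addrI s)) /=; apply: eq_bigr => t _.
  by rewrite [s + t]addrC addrK psiD; ring.
rewrite exchange_big /= (bigD1 0) //=; congr (_ + _).
  rewrite mulr_sumr; apply: eq_bigr => s _.
  by rewrite psi0 mulr1 sub0r -[- s]mulN1r c2M mulrCA.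
rewrite mulr_sumr; apply: eq_bigr => u u0.
rewrite -(sum_scale _ u0) /jacobi_sum mulr_suml; apply: eq_bigr => t _.
rewrite c1M -[X in X - u * t]mulr1 -mulrBr c2M; ring.
Qed.

Lemma gauss_sumM_nontrivial psi chi1 chi2 b :
    addchar psi -> mulchar chi1 -> mulchar chi2 ->
    b != 0 -> chi1 b * chi2 b != 1 ->
  gauss_sum psi chi1 * gauss_sum psi chi2 =
  jacobi_sum chi1 chi2 * gauss_sum psi (fun t => chi1 t * chi2 t).
Proof.
move=> apsi m1 m2 b0 b1; rewrite gauss_sumM //.
have -> : \sum_t chi1 t * chi2 t = 0.
  exact: (sum_mulchar (mulcharMf m1 m2) b0 b1).
rewrite mulr0 add0r.
congr (_ * _); rewrite /gauss_sum [RHS](bigD1 0) //=.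
by case: m1 => -> _ _; rewrite !mul0r add0r.
Qed.

(** When the product of the characters is trivial, the Jacobi sum is a sum of
    [chi1 (t / (1 - t))], in which every value except -1 is taken once. *)
Lemma gauss_sumM_trivial psi chi1 chi2 b :
    addchar psi -> mulchar chi1 -> mulchar chi2 ->
    (forall t, t != 0 -> chi1 t * chi2 t = 1) ->
    b != 0 -> chi1 b != 1 ->
  gauss_sum psi chi1 * gauss_sum psi chi2 = chi1 (-1) * #|F|%:R.
Proof.
move=> apsi m1 m2 c12 b0 b1; rewrite gauss_sumM //.
case: (m1) => c10 c11 c1M; case: (m2) => c20 c21 c2M.
case: (apsi) => psi0 psiD psiS.
have N10 : (-1 : F) != 0 by rewrite oppr_eq0 oner_eq0.
have c2N : chi2 (-1) = chi1 (-1).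
  have e1 : chi1 (-1) * chi1 (-1) = 1 by rewrite -c1M mulrNN mulr1.
  by apply: (mulfI (mulchar_neq0 m1 N10)); rewrite c12 // e1.
have -> : \sum_t chi1 t * chi2 t = #|F|%:R - 1.
  rewrite (bigD1 0) //= c10 mul0r add0r.
  rewrite (eq_bigr (fun=> 1)); last by move=> t t0; rewrite c12.
  have := sumr_const (xpredT : pred F) (1 : K); rewrite (bigD1 0) //= => <-.
  by rewrite [1 + _]addrC addrK.
have -> : \sum_(u | u != 0) chi1 u * chi2 u * psi u = -1.
  have := psiS; rewrite (bigD1 0) //= psi0 => /eqP; rewrite addrC addr_eq0 => /eqP <-.
  by apply: eq_bigr => u u0; rewrite c12 // mul1r.
have -> : jacobi_sum chi1 chi2 = - chi1 (-1).
  rewrite /jacobi_sum (bigD1 1) //= subrr c20 mulr0 add0r.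
  transitivity (\sum_(t | t != -1) chi1 t); last first.
    have := sum_mulchar m1 b0 b1; rewrite (bigD1 (-1)) //= => /eqP.
    by rewrite addrC addr_eq0 => /eqP.
  pose h (v : F) := v / (1 + v).
  have hP (v : F) : v != -1 -> 1 + v != 0 by rewrite addrC addr_eq0.
  have h1 (v : F) : v != -1 -> 1 - h v = (1 + v)^-1.
    by move=> /hP v1; rewrite /h; field.
  rewrite (reindex_onto h (fun t => t / (1 - t))) /=; last first.
    move=> t t1; have t1' : 1 - t != 0 by rewrite subr_eq0 eq_sym.
    rewrite /h; field; rewrite t1' /=.
    by rewrite (_ : 1 - t + t = 1) ?oner_eq0 //; ring.
  apply: eq_big => v.
    apply/andP/idP => [[n1 /eqP e1]|v1].
      apply/eqP=> vN; move: e1; rewrite /h vN subrr invr0 mulr0 subr0 mul0r.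
      by move/eqP; rewrite eq_sym oppr_eq0 oner_eq0.
    have v1' := hP _ v1; split.
      by rewrite -subr_eq0 -oppr_eq0 opprB h1 // invr_eq0.
    by rewrite h1 // invrK /h mulfVK.
  move=> /andP[_ /eqP e1].
  have v1 : v != -1.
    apply/eqP=> vN; move: e1; rewrite /h vN subrr invr0 mulr0 subr0 mul0r.
    by move/eqP; rewrite eq_sym oppr_eq0 oner_eq0.
  have v1' := hP _ v1.
  by rewrite h1 // /h c1M -mulrA c12 ?invr_eq0 // mulr1.
by rewrite c2N; ring.
Qed.

End CharacterSums.

(** * Quartic residue characters *)

Section QuarticCharacter.

Variables (F : finFieldType) (f : F).
Hypothesis f_prim : 4.-primitive_root f.

Let m := (#|F|.-1 %/ 4)%N.

(** The discrete logarithm to base [f] of the quartic residue symbol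
    [t ^+ ((#|F| - 1) / 4)], which is a fourth root of unity. *)
Definition qlog (t : F) : nat :=
  if [pick e : 'I_4 | t ^+ (#|F|.-1 %/ 4) == f ^+ e] is Some e then e else 0%N.

(** The same symbol read in a ring where [w] takes the place of [f]: the
    characters of order dividing 4 with values in any field arise in this way. *)
Definition qchar (K : pzRingType) (w : K) (t : F) : K :=
  if t == 0 then 0 else w ^+ qlog t.

(** Real and imaginary part of the quartic character with values in the Gaussian
    integers; as integers they can be reduced to any characteristic. *)
Definition qre (t : F) : int :=
  if t == 0 then 0 else nth 0 [:: 1; 0; -1; 0] (qlog t).
Definition qim (t : F) : int :=
  if t == 0 then 0 else nth 0 [:: 0; 1; 0; -1] (qlog t).

Lemma expf_pred_card (t : F) : t != 0 -> t ^+ #|F|.-1 = 1.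
Proof.
move=> t0; apply: (mulfI t0); rewrite -exprS prednK ?expf_card ?mulr1 //.
exact: ltnW (finNzRing_gt1 F).
Qed.

Lemma qprim_neq0 : f != 0.
Proof.
apply/eqP=> f0; have := prim_expr_order f_prim.
by rewrite f0 expr0n /= => /esym/eqP; rewrite oner_eq0.
Qed.

Lemma dvdn4_pred_card : (4 %| #|F|.-1)%N.
Proof. by rewrite (prim_order_dvd f_prim) expf_pred_card ?qprim_neq0. Qed.

Lemma qprim_sqr : f ^+ 2 = -1.
Proof.
have : (f ^+ 2 - 1) * (f ^+ 2 + 1) == 0.
  rewrite -subr_sqr -exprM expr1n subr_eq0; apply/eqP.
  exact: prim_expr_order f_prim.
rewrite mulf_eq0 subr_eq0 addr_eq0 => /orP[|/eqP //].
by rewrite -(prim_order_dvd f_prim).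
Qed.

Lemma qlog_lt4 t : (qlog t < 4)%N.
Proof. by rewrite /qlog; case: pickP => [e _|//]; apply: ltn_ord. Qed.

Lemma qlogP t : t != 0 -> t ^+ (#|F|.-1 %/ 4) = f ^+ qlog t.
Proof.
move=> t0; rewrite /qlog; case: pickP => [e /eqP //|no].
have : (t ^+ m) ^+ 4 = 1.
  by rewrite -exprM divnK ?dvdn4_pred_card // expf_pred_card.
by move=> /(prim_rootP f_prim)[e /eqP]; rewrite no.
Qed.

Lemma qlogE t e : t != 0 -> t ^+ (#|F|.-1 %/ 4) = f ^+ e -> qlog t = e %[mod 4].
Proof.
by move=> t0 te; apply/eqP; rewrite -(eq_prim_root_expr f_prim) -qlogP // te.
Qed.

Lemma qlogM a b : a != 0 -> b != 0 -> qlog (a * b) = qlog a + qlog b %[mod 4].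
Proof.
by move=> a0 b0; apply: qlogE; rewrite ?mulf_neq0 // exprMn !qlogP // exprD.
Qed.

Lemma qlog1 : qlog 1 = 0%N.
Proof.
have := @qlogE 1 0; rewrite expr1n oner_neq0 => /(_ isT erefl).
by rewrite !modn_small ?qlog_lt4.
Qed.

Lemma qlogX a n : a != 0 -> qlog (a ^+ n) = n * qlog a %[mod 4].
Proof.
move=> a0; apply: qlogE; rewrite ?expf_neq0 //.
by rewrite -exprM mulnC exprM qlogP // -exprM mulnC.
Qed.

Lemma qlogN1_even : ~~ odd (qlog (-1)).
Proof.
have := qlogX 2 qprim_neq0; rewrite qprim_sqr => e.
have /(congr1 odd) : (qlog (-1)%R %% 4 = (2 * qlog f) %% 4)%N by [].
by rewrite !(modn_small (qlog_lt4 _)) => ->; rewrite odd_mod // oddM.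
Qed.

Lemma nonzero_elements : exists rs : seq F,
  [/\ uniq rs, size rs = #|F|.-1 & all (predC1 0) rs].
Proof.
exists [seq x <- enum F | x != 0]; split.
- by rewrite filter_uniq ?enum_uniq.
- rewrite -(cardC1 (0 : F)) cardE; congr size.
  rewrite enumT /enum_mem; apply: eq_filter => x.
  by rewrite inE.
- by rewrite filter_all.
Qed.

(** A generator of the multiplicative group is not a square, hence its exponent is
    odd; in particular the quartic character has order 4. *)
Lemma ex_generator :
  exists g : F, [/\ (#|F|.-1).-primitive_root g, g != 0 & odd (qlog g)].
Proof.
have [rs [rs_uniq rs_size rs0]] := nonzero_elements.
have n0 : (0 < #|F|.-1)%N.
  by have := finNzRing_gt1 F; case: #|F| => [|[]].
have : has (#|F|.-1).-primitive_root rs.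
  apply: has_prim_root; rewrite ?rs_size //.
  apply/allP => x /(allP rs0)/= x0; rewrite unity_rootE.
  by rewrite expf_pred_card.
move=> /hasP[g /(allP rs0)/= g0 g_prim]; exists g; split=> //.
apply/negP => /negP/even_halfK ev.
have fe : (f ^+ qlog g) ^+ 2 = 1.
  by rewrite -ev -mul2n exprM qprim_sqr exprAC sqrrN !expr1n.
have /eqP : g ^+ (#|F|.-1 %/ 4 * 2) = 1 by rewrite exprM qlogP.
rewrite -(prim_order_dvd g_prim) => /dvdnP[k].
have /dvdnP[j ej] := dvdn4_pred_card; move: n0; rewrite ej mulnK //.
by case: k => [|k]; lia.
Qed.

Lemma sum_expf k : (0 < k < #|F|.-1)%N -> \sum_(t : F) t ^+ k = 0.
Proof.
move=> /andP[k0 kN].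
have [rs [rs_uniq rs_size rs0]] := nonzero_elements.
case: (boolP (all k.-unity_root rs)) => [|/allPn[b /(allP rs0)/= b0]].
  by move=> /max_unity_roots => /(_ k0 rs_uniq); rewrite rs_size leqNgt kN.
rewrite unity_rootE => b1.
apply: (@sum_mulchar _ _ (fun t : F => t ^+ k) b) => //.
by split; rewrite ?expr0n ?expr1n -?lt0n ?(gtn_eqF k0) // => x y; rewrite exprMn.
Qed.

Section Values.

Variables (K : pzRingType) (w : K).
Hypothesis w4 : w ^+ 4 = 1.

Lemma expr_mod4 a b : a = b %[mod 4] -> w ^+ a = w ^+ b.
Proof. by move=> ab; rewrite -(expr_mod a w4) ab expr_mod. Qed.

Lemma qchar0 : qchar w 0 = 0. Proof. by rewrite /qchar eqxx. Qed.

Lemma qchar1 : qchar w 1 = 1.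
Proof. by rewrite /qchar oner_eq0 qlog1. Qed.

Lemma qcharM a b : qchar w (a * b) = qchar w a * qchar w b.
Proof.
rewrite /qchar mulf_eq0; case: eqP => [_|/eqP a0]; first by rewrite mul0r.
case: eqP => [_|/eqP b0] /=; first by rewrite mulr0.
by rewrite -exprD; apply/expr_mod4/qlogM.
Qed.

End Values.

Lemma qchar_expr (K : pzRingType) (w : K) k t :
  (0 < k)%N -> qchar (w ^+ k) t = qchar w t ^+ k.
Proof.
rewrite /qchar; case: eqP => _; last by rewrite exprAC.
by rewrite expr0n; case: k.
Qed.

Lemma qchar_mul (K : comPzRingType) (w v : K) t :
  qchar w t * qchar v t = qchar (w * v) t.
Proof. by rewrite /qchar; case: eqP => _; rewrite ?mul0r // exprMn. Qed.

Lemma qchar_self t : qchar f t = t ^+ (#|F|.-1 %/ 4).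
Proof.
rewrite /qchar; case: eqP => [->|/eqP /qlogP //].
rewrite expr0n; case: eqP => // e.
have := dvdn4_pred_card => /dvdnP[j ej]; move: e; rewrite ej mulnK // => j0.
by have := finNzRing_gt1 F; move: ej; rewrite j0; case: #|F| => [|[]].
Qed.

Lemma qcharE (K : pzRingType) (w : K) t : w ^+ 2 = -1 ->
  qchar w t = (qre t)%:~R + (qim t)%:~R * w.
Proof.
move=> w2; rewrite /qchar /qre /qim; case: eqP => _; first by rewrite mul0r addr0.
have := qlog_lt4 t; case: (qlog t) => [|[|[|[|//]]]] _ /=.
- by rewrite mul0r addr0.
- by rewrite add0r mul1r.
- by rewrite w2 mul0r addr0 mulrN1z.
- by rewrite exprSr w2 mulrN1z add0r.
Qed.

Lemma qchar_int (K : pzRingType) t : qchar (-1 : K) t = (qchar (-1 : int) t)%:~R.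
Proof.
by rewrite /qchar; case: eqP => _ //; rewrite rmorphXn /= rmorphN1.
Qed.

End QuarticCharacter.

(** * The Jacobi sum of the quartic and the quadratic character *)

Section QuarticJacobi.

Variables (F : finFieldType) (f : F).
Hypothesis f_prim : 4.-primitive_root f.

Definition jacobi_re : int := \sum_u qre f u * qchar f (-1 : int) (1 - u).
Definition jacobi_im : int := \sum_u qim f u * qchar f (-1 : int) (1 - u).

Lemma sqrN1_expr4 (K : pzRingType) (w : K) : w ^+ 2 = -1 -> w ^+ 4 = 1.
Proof. by move=> w2; rewrite (exprM w 2 2) w2 sqrrN expr1n. Qed.

Lemma sqrN1_4 (K : pzRingType) : (-1 : K) ^+ 4 = 1.
Proof. by rewrite (exprM _ 2 2) sqrrN !expr1n. Qed.

Lemma qchar_mulchar (K : fieldType) (w : K) : w ^+ 4 = 1 -> mulchar (qchar f w).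
Proof.
by move=> w4; split; [exact: qchar0|exact: qchar1|exact: qcharM].
Qed.

Lemma jacobi_sumE (K : fieldType) (w : K) : w ^+ 2 = -1 ->
  jacobi_sum (qchar f w) (qchar f (-1)) = jacobi_re%:~R + jacobi_im%:~R * w.
Proof.
move=> w2; rewrite /jacobi_sum /jacobi_re /jacobi_im !rmorph_sum mulr_suml /=.
rewrite -big_split /=; apply: eq_bigr => u _.
by rewrite qcharE // qchar_int !rmorphM /=; ring.
Qed.

Section Field.

Variables (K : fieldType) (w : K) (psi : F -> K).
Hypotheses (w2 : w ^+ 2 = -1) (two_neq0 : 2%:R != 0 :> K) (psiP : addchar psi).

Let G := gauss_sum psi (qchar f w).
Let Gbar := gauss_sum psi (qchar f (- w)).
Let G2 := gauss_sum psi (qchar f (-1 : K)).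
Let J := jacobi_re%:~R + jacobi_im%:~R * w.
Let Jbar := jacobi_re%:~R - jacobi_im%:~R * w.

Let w4 : w ^+ 4 = 1. Proof. exact: sqrN1_expr4. Qed.
Let Nw2 : (- w) ^+ 2 = -1. Proof. by rewrite sqrrN. Qed.
Let Nw4 : (- w) ^+ 4 = 1. Proof. exact: sqrN1_expr4. Qed.

Lemma oner_neqN1 : (1 : K) != -1.
Proof. by rewrite -addr_eq0. Qed.

Lemma qchar_nontrivial (v : K) : v ^+ 2 = -1 \/ v = -1 ->
  exists2 b : F, b != 0 & qchar f v b != 1.
Proof.
move=> v2; have [b [_ b0 bo]] := ex_generator f_prim; exists b => //.
rewrite /qchar (negPf b0) -(odd_double_half (qlog f b)) bo exprD expr1 -mul2n.
rewrite exprM; case: v2 => [v2|->].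
  rewrite v2; apply/eqP=> /(congr1 (fun t => t ^+ 2)); rewrite exprMn v2.
  by rewrite exprAC sqrrN !expr1n mulr1 => /eqP; rewrite eq_sym (negPf oner_neqN1).
by rewrite sqrrN !expr1n mulr1 eq_sym oner_neqN1.
Qed.

Lemma gauss_mul_quadratic : G * G2 = J * Gbar.
Proof.
have [b b0 bN] : exists2 b : F, b != 0 & qchar f (- w) b != 1.
  by apply: qchar_nontrivial; left.
rewrite /G /G2 (@gauss_sumM_nontrivial _ _ _ _ _ b) ?jacobi_sumE //.
- congr (_ * _); apply: eq_bigr => t _; rewrite qchar_mul mulrN1 //.
- exact: qchar_mulchar.
- exact/qchar_mulchar/sqrN1_4.
- by rewrite qchar_mul mulrN1.
Qed.

Lemma gauss_bar_mul_quadratic : Gbar * G2 = Jbar * G.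
Proof.
have [b b0 bN] : exists2 b : F, b != 0 & qchar f w b != 1.
  by apply: qchar_nontrivial; left.
rewrite /Gbar /G2 (@gauss_sumM_nontrivial _ _ _ _ _ b) ?jacobi_sumE //.
- rewrite mulrN; congr (_ * _).
  by apply: eq_bigr => t _; rewrite qchar_mul mulrNN mulr1.
- exact: qchar_mulchar.
- exact/qchar_mulchar/sqrN1_4.
- by rewrite qchar_mul mulrNN mulr1.
Qed.

Lemma qchar_mulN t : t != 0 -> qchar f w t * qchar f (- w) t = 1.
Proof.
move=> t0; rewrite qchar_mul mulrN -expr2 w2 opprK /qchar (negPf t0).
by rewrite expr1n.
Qed.

Lemma gauss_mul_bar : G * Gbar = qchar f w (-1) * #|F|%:R.
Proof.
have [b b0 bN] : exists2 b : F, b != 0 & qchar f w b != 1.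
  by apply: qchar_nontrivial; left.
apply: (gauss_sumM_trivial psiP _ _ _ b0 bN); try exact: qchar_mulchar.
exact: qchar_mulN.
Qed.

Lemma gauss_quadratic_sqr : G2 * G2 = #|F|%:R.
Proof.
have [b b0 bN] : exists2 b : F, b != 0 & qchar f (-1 : K) b != 1.
  by apply: qchar_nontrivial; right.
rewrite (gauss_sumM_trivial psiP _ _ _ b0 bN); last first.
- by move=> t t0; rewrite qchar_mul mulrNN mulr1 /qchar (negPf t0) expr1n.
- exact/qchar_mulchar/sqrN1_4.
- exact/qchar_mulchar/sqrN1_4.
rewrite /qchar oppr_eq0 oner_eq0 -signr_odd (negPf (qlogN1_even f_prim)).
by rewrite mul1r.
Qed.

Hypothesis N_neq0 : #|F|%:R != 0 :> K.

Lemma qcharN1_neq0 : qchar f w (-1) != 0.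
Proof.
by apply: mulchar_neq0; rewrite ?oppr_eq0 ?oner_eq0 //; exact: qchar_mulchar.
Qed.

Lemma gauss_neq0 : G != 0.
Proof.
apply/eqP=> G0; have := gauss_mul_bar; rewrite G0 mul0r => /esym/eqP.
by rewrite mulf_eq0 (negPf qcharN1_neq0) (negPf N_neq0).
Qed.

(** Over the complex numbers this is the factorization of [#|F|] as the norm of a
    Gaussian integer. *)
Lemma jacobi_norm : J * Jbar = #|F|%:R.
Proof.
have Gb0 : Gbar != 0.
  apply/eqP=> G0; have := gauss_mul_bar; rewrite G0 mulr0 => /esym/eqP.
  by rewrite mulf_eq0 (negPf qcharN1_neq0) (negPf N_neq0).
apply: (mulfI (mulf_neq0 gauss_neq0 Gb0)).
transitivity ((J * Gbar) * (Jbar * G)); first by ring.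
rewrite -gauss_mul_quadratic -gauss_bar_mul_quadratic -gauss_quadratic_sqr; ring.
Qed.

(** Multiplying by [G2 ^ 2 = #|F|] turns [G ^ 4] into [(G * G2) ^ 2 * G ^ 2], which
    is [J ^ 2 * (G * Gbar) ^ 2]. *)
Lemma gauss_expr4 : G ^+ 4 = J ^+ 2 * #|F|%:R.
Proof.
apply: (mulfI N_neq0).
transitivity ((G * G2) * (G * G2) * G ^+ 2).
  by rewrite -gauss_quadratic_sqr; ring.
rewrite gauss_mul_quadratic.
transitivity (J ^+ 2 * (G * Gbar) ^+ 2); first by ring.
rewrite gauss_mul_bar exprMn.
rewrite (_ : qchar f w (-1) ^+ 2 = 1); first by ring.
by rewrite expr2 -qcharM // mulrNN mulr1 qchar1.
Qed.

End Field.

(** In the field itself the quartic symbol is a power, so the Jacobi sum is a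
    sum of values of a polynomial of degree less than [#|F| - 1]. *)
Lemma jacobi_root : jacobi_re%:~R + jacobi_im%:~R * f = 0.
Proof.
have f2 := qprim_sqr f_prim.
rewrite -jacobi_sumE // /jacobi_sum -f2.
set n := (#|F|.-1 %/ 4)%N.
have n4 : (n * 4 = #|F|.-1)%N by rewrite divnK // (dvdn4_pred_card f_prim).
have n0 : (0 < n)%N.
  by have := finNzRing_gt1 F; move: n4; case: #|F| => [|[|N]] //=; case: n.
transitivity (\sum_(t : F) \sum_(j < (2 * n).+1) t ^+ (n + j) *
    ((-1) ^+ j *+ 'C(2 * n, j))).
  apply: eq_bigr => t _; rewrite qchar_expr // !qchar_self // -exprM mulnC.
  rewrite exprBn mulr_sumr; apply: eq_bigr => j _.
  by rewrite expr1n mulr1 exprD -mulrA !mulrnAr [t ^+ j * _]mulrC.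
rewrite exchange_big big1 // => j _; rewrite -mulr_suml sum_expf ?mul0r //.
by have := ltn_ord j; lia.
Qed.

Lemma sum_qchar_int : \sum_u qchar f (-1 : int) u = 0.
Proof.
apply/eqP; rewrite -(intr_eq0 rat) rmorph_sum /=; apply/eqP.
under eq_bigr do rewrite -qchar_int.
have [|b b0 bN] := @qchar_nontrivial rat isT (-1); first by right.
by apply: (sum_mulchar _ b0 bN); exact/qchar_mulchar/sqrN1_4.
Qed.

Lemma sum_qre_qim : \sum_u qre f u = 0 /\ \sum_u qim f u = 0.
Proof.
set A := \sum_u qre f u; set B := \sum_u qim f u.
have i2 : ('i : algC) ^+ 2 = -1 by exact: sqrCi.
have : A%:~R + B%:~R * 'i = 0 :> algC.
  have two0 : 2%:R != 0 :> algC by rewrite pnatr_eq0.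
  have [|b b0 bN] := qchar_nontrivial two0 (v := 'i); first by left.
  rewrite -[RHS](sum_mulchar (qchar_mulchar (sqrN1_expr4 i2)) b0 bN).
  rewrite !rmorph_sum mulr_suml -big_split /=; apply: eq_bigr => u _.
  by rewrite qcharE.
move=> /(congr1 (fun z => z * (A%:~R - B%:~R * 'i))).
rewrite mul0r => e; have : A ^+ 2 + B ^+ 2 = 0.
  apply/eqP; rewrite -(intr_eq0 algC) rmorphD !rmorphXn /= -e; apply/eqP.
  transitivity (A%:~R ^+ 2 - B%:~R ^+ 2 * 'i ^+ 2 : algC); last by ring.
  by rewrite i2; ring.
by move=> ?; split; nia.
Qed.

Lemma qchar_sub1 u : u != 0 -> (2 %| qchar f (-1 : int) u - 1)%Z.
Proof.
by move=> u0; rewrite /qchar (negPf u0) -signr_odd; case: odd.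
Qed.

(** The product of [Re chi + Im chi - 1] and [rho - 1], where [chi] is the
    quartic and [rho] the quadratic character, takes values divisible by 4. *)
Lemma jacobi_mod4 : (4 %| jacobi_re + jacobi_im + #|F|%:Z)%Z.
Proof.
have [re0 im0] := sum_qre_qim; have ch0 := sum_qchar_int.
pose s (u : F) := qre f u + qim f u; pose c (u : F) := qchar f (-1 : int) (1 - u).
have s0 : \sum_u s u = 0 by rewrite /s big_split /= re0 im0.
have c0 : \sum_u c u = 0.
  rewrite -[RHS]ch0 /c (reindex_inj (can_inj (subKr 1))) /=.
  by apply: eq_bigr => u _; rewrite subKr.
have q10 : qre f 1 = 1 by rewrite /qre oner_eq0 qlog1.
have q11 : qim f 1 = 0 by rewrite /qim oner_eq0 qlog1.
have -> : jacobi_re + jacobi_im + #|F|%:Z =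
    \sum_(u | (u != 0) && (u != 1)) (s u - 1) * (c u - 1).
  have tot : \sum_u (s u - 1) * (c u - 1) = jacobi_re + jacobi_im + #|F|%:Z.
    transitivity (\sum_u (s u * c u - (s u + c u) + 1)).
      by apply: eq_bigr => u _; ring.
    rewrite big_split sumrB big_split /= s0 c0 sumr_const.
    rewrite add0r subr0 natz; congr (_ + _).
    by rewrite -big_split; apply: eq_bigr => u _; rewrite mulrDl.
  rewrite -tot (bigD1 0) //= (bigD1 1) ?oner_eq0 //=.
  have -> : s 1 = 1 by rewrite /s q10 q11.
  have -> : c 0 = 1 by rewrite /c subr0 qchar1.
  by rewrite !subrr mul0r mulr0 !add0r.
apply: rpred_sum => u /andP[u0 u1].
have u1' : 1 - u != 0 by rewrite subr_eq0 eq_sym.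
have /dvdzP[j ->] := qchar_sub1 u1'.
have /dvdzP[k ->] : (2 %| s u - 1)%Z.
  rewrite /s /qre /qim (negPf u0); have := qlog_lt4 f u.
  by case: (qlog f u) => [|[|[|[|]]]].
by rewrite mulrACA dvdz_mull.
Qed.

(** As the quadratic character is odd off 0 and the imaginary parts sum to 0,
    subtracting 1 from the former makes every term even. *)
Lemma jacobi_im_even : (2 %| jacobi_im)%Z.
Proof.
have [_ im0] := sum_qre_qim.
have -> : jacobi_im = \sum_u qim f u * (qchar f (-1 : int) (1 - u) - 1).
  transitivity (jacobi_im - \sum_u qim f u); first by rewrite im0 subr0.
  rewrite -sumrB; apply: eq_bigr => u _; ring.
apply: rpred_sum => u _; case: (eqVneq u 1) => [->|u1].
  by rewrite /qim oner_eq0 qlog1 //= mul0r dvdz0.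
by rewrite dvdz_mull // qchar_sub1 // subr_eq0 eq_sym.
Qed.

End QuarticJacobi.

(** * Primes that are sums of two squares *)

(** In characteristic different from 2, a square root of -1 has order 4. *)
Lemma sqrN1_prim (K : fieldType) (w : K) :
  2%:R != 0 :> K -> w ^+ 2 = -1 -> 4.-primitive_root w.
Proof.
move=> two0 w2; have [m mw] := prim_order_exists (n := 4) isT (sqrN1_expr4 w2).
have n11 : (1 : K) != -1 by rewrite -addr_eq0.
case: m mw => [|[|[|[|[|m]]]]] mw //.
- by move: w2; rewrite (prim_expr_order mw : w = 1) expr1n => /eqP; rewrite (negPf n11).
- by move: w2; rewrite (prim_expr_order mw) => /eqP; rewrite (negPf n11).
Qed.

Lemma addchar_Fp (p : nat) (K : fieldType) (z : K) : prime p ->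
  z ^+ p = 1 -> z != 1 -> addchar (fun t : 'F_p => z ^+ t).
Proof.
move=> p_pr zp z1.
have D : {morph (fun t : 'F_p => z ^+ t) : s t / s + t >-> s * t}.
  move=> s t /=; rewrite -exprD -[in RHS](expr_mod _ zp).
  by congr (_ ^+ (_ %% _)); apply: Fp_cast.
have one : z ^+ (1%R : 'F_p) = z by [].
split=> //; apply/eqP.
have : (z - 1) * \sum_(t : 'F_p) z ^+ t == 0.
  rewrite mulrBl mul1r subr_eq0 [X in _ == X](reindex_inj (addrI 1)) /= mulr_sumr.
  by apply/eqP/eq_bigr => t _; rewrite -{1}one; exact/esym/(D 1%R t).
by rewrite mulf_eq0 subr_eq0 (negPf z1).
Qed.

(** In an algebraically closed field, [1 + X + ... + X ^ (p - 1)] has a root. *)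
Lemma ex_unity_root (K : closedFieldType) (p : nat) : prime p ->
  p%:R != 0 :> K -> exists2 z : K, z ^+ p = 1 & z != 1.
Proof.
move=> p_pr p0; have p1 := prime_gt1 p_pr.
pose P : {poly K} := \poly_(i < p) 1.
have sP : size P = p by rewrite size_poly_eq ?oner_eq0.
have /closed_rootP[z /eqP Pz] : size P != 1%N by rewrite sP neq_ltn p1 orbT.
have Ez : \sum_(i < p) z ^+ i = 0.
  by rewrite -[RHS]Pz horner_poly; apply: eq_bigr => i _; rewrite mul1r.
exists z; first by apply/eqP; rewrite -subr_eq0 subrX1 Ez mulr0.
apply/eqP=> z1; move/eqP: p0; apply; rewrite -[RHS]Ez z1.
by under eq_bigr do rewrite expr1n; rewrite sumr_const card_ord.
Qed.

Lemma Fp_int_eq0 (p : nat) (n : int) : prime p ->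
  (n%:~R == 0 :> 'F_p) = (p%:Z %| n)%Z.
Proof. by move=> p_pr; rewrite (dvdz_pcharf (pchar_Fp p_pr)). Qed.

Lemma Fp_nat_eq0 (p n : nat) : prime p -> (n%:R == 0 :> 'F_p) = (p %| n)%N.
Proof. by move=> p_pr; rewrite (dvdn_pcharf (pchar_Fp p_pr)). Qed.

Lemma dvdz_small (p : nat) (a : int) : (p%:Z %| a)%Z -> a ^+ 2 < p%:Z ^+ 2 -> a = 0.
Proof.
move=> /dvdzP[k ->]; case: (eqVneq k 0) => [-> _|k0]; first by rewrite mul0r.
have k1 : 1 <= k ^+ 2 by nia.
by rewrite exprMn ltNge ler_peMl ?sqr_ge0.
Qed.

Lemma sqr_le1_unit (k : int) : k != 0 -> k ^+ 2 <= 1 -> k = 1 \/ k = -1.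
Proof. by case: k => [[|[|k]]|[|k]]; nia. Qed.

Lemma unit_sign_mod4 (k a c : int) (x j : nat) : ~~ odd x ->
  k * (4 * a + 1) + k * x%:Z + (4 * j + 1)%N%:Z = c * 4 -> k = 1 \/ k = -1 ->
  k = if (4 %| x)%N then -1 else 1.
Proof. by move=> x2 e [ke|ke]; rewrite ke in e *; case: ifP; lia. Qed.

Definition sqsum (alpha : int) (x : nat) : nat := absz (alpha ^+ 2 + x%:Z ^+ 2).

(** The square root of -1 modulo [alpha ^ 2 + x ^ 2] to which the Gaussian prime
    [alpha + i x] sends [i]. *)
Definition sqrtN1 (alpha : int) (x : nat) : 'F_(sqsum alpha x) :=
  x%:R / alpha%:~R.

(** Exponent of [i] in the quartic residue symbol of [D] modulo [alpha + i x]. *)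
Definition qsym (alpha : int) (x : nat) (D : int) : nat :=
  qlog (sqrtN1 alpha x) D%:~R.

Section TwoSquares.

Variables (alpha : int) (x : nat).
Hypotheses (alpha1 : (4 %| alpha - 1)%Z) (x_even : ~~ odd x).
Hypothesis p_pr : prime (sqsum alpha x).

Let p := sqsum alpha x.
Let f := sqrtN1 alpha x.

Lemma sqsumE : p%:Z = alpha ^+ 2 + x%:Z ^+ 2.
Proof. by rewrite /p /sqsum gez0_abs // addr_ge0 ?sqr_ge0. Qed.

Lemma sqsum_x_gt0 : (0 < x)%N.
Proof.
rewrite lt0n; apply/eqP=> x0; have := p_pr; rewrite /sqsum x0 expr0n addr0.
rewrite expr2 abszM => pr; have := prime_gt1 pr.
have /primeP[_ /(_ `|alpha|%N)] := pr; rewrite dvdn_mulr // => /(_ isT).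
by case/orP=> /eqP; nia.
Qed.

Lemma sqsum_ndvd_alpha : ~~ (p%:Z %| alpha)%Z.
Proof.
apply/negP => /dvdz_small; have pE := sqsumE; have x0 := sqsum_x_gt0.
have p1 := prime_gt1 p_pr.
have -> : alpha ^+ 2 < p%:Z ^+ 2.
  rewrite (@lt_le_trans _ _ p%:Z) //; first by rewrite pE ltrDl exprn_gt0.
  by rewrite expr2 ler_peMl // lez_nat ltnW.
by case/dvdzP: alpha1 => k ka /(_ isT) => a0; lia.
Qed.

Lemma alpha_neq0_Fp : alpha%:~R != 0 :> 'F_p.
Proof. by rewrite Fp_int_eq0 // sqsum_ndvd_alpha. Qed.

Lemma sqrtN1_sqr : f ^+ 2 = -1.
Proof.
have : (alpha%:~R ^+ 2 + x%:R ^+ 2 : 'F_p) = 0.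
  transitivity ((p%:Z)%:~R : 'F_p); last by apply/eqP; rewrite Fp_int_eq0 // dvdzz.
  by rewrite sqsumE rmorphD !rmorphXn.
have a0 := alpha_neq0_Fp.
move=> /eqP; rewrite addrC addr_eq0 => /eqP e.
rewrite /f /sqrtN1 expr_div_n e mulNr. by rewrite divff ?expf_neq0.
Qed.

Lemma sqsum_mod4 : exists k : nat, p = (4 * k + 1)%N /\ x = (2 * k)%N %[mod 4].
Proof.
case/dvdzP: alpha1 => a ea; have pE := sqsumE.
have x2 := even_halfK x_even; set y := x./2 in x2.
have [c ec] : exists c : int, y%:Z ^+ 2 = y%:Z + 2 * c.
  exists 'C(y, 2)%:Z.
  have e2 : (2 * 'C(y, 2) = y * y.-1)%N.
    by rewrite mul2n bin2 even_halfK // oddM; case: (y) => [|n] //=; case: odd.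
  have ey : (y * y = y + 2 * 'C(y, 2))%N by rewrite e2; case: (y) => [|n] //; lia.
  by have := congr1 Posz ey; lia.
have b0 : 0 <= 4 * a ^+ 2 + 2 * a + y%:Z ^+ 2 by nia.
have eb := gez0_abs b0; set b := absz _ in eb; exists b; split.
  apply/eqP; rewrite -eqz_nat; apply/eqP.
  rewrite pE -x2 PoszD PoszM eb (_ : alpha = 4 * a + 1); last by lia.
  by rewrite -mul2n PoszM; ring.
have : b%:Z = 2 * (2 * a ^+ 2 + a + c) + y%:Z by rewrite eb ec; lia.
by move: (2 * a ^+ 2 + a + c) => t et; lia.
Qed.

Lemma sqsum_odd : odd p.
Proof. by have [k [-> _]] := sqsum_mod4; lia. Qed.

Lemma two_neq0_Fp : 2%:R != 0 :> 'F_p.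
Proof.
rewrite Fp_nat_eq0 // dvdn_prime2 //; apply/eqP => p2.
by have := sqsum_odd; rewrite p2.
Qed.

Lemma sqrtN1_prim : 4.-primitive_root f.
Proof. exact: sqrN1_prim two_neq0_Fp sqrtN1_sqr. Qed.

Lemma jacobi_norm_int :
  jacobi_re f ^+ 2 + jacobi_im f ^+ 2 = p.
Proof.
have i2 : ('i : algC) ^+ 2 = -1 by exact: sqrCi.
have two0 : 2%:R != 0 :> algC by rewrite pnatr_eq0.
have p0 : p%:R != 0 :> algC by rewrite pnatr_eq0 -lt0n prime_gt0.
have [z zp z1] := ex_unity_root p_pr p0.
have cF := card_Fp p_pr.
have := jacobi_norm sqrtN1_prim i2 two0 (addchar_Fp p_pr zp z1).
rewrite cF => /(_ p0) e; apply/eqP; rewrite -(eqr_int algC) -[X in _ == X]e.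
apply/eqP; rewrite rmorphD !rmorphXn /=.
set A := (jacobi_re f)%:~R; set B := (jacobi_im f)%:~R.
transitivity (A ^+ 2 - B ^+ 2 * 'i ^+ 2); last by ring.
by rewrite i2; ring.
Qed.

(** A prime has only one representation as a sum of two squares; that [p] divides
    the real part of [(A + i B) (alpha - i x)] singles out the conjugate, and the
    congruence modulo 4 the sign. *)
Lemma jacobi_eq :
  let k : int := if (4 %| x)%N then -1 else 1 in
  jacobi_re f = k * alpha /\ jacobi_im f = k * x%:Z.
Proof.
have pE := sqsumE; have norm := jacobi_norm_int.
have root := jacobi_root sqrtN1_prim; have m4 := jacobi_mod4 sqrtN1_prim.
have ev := jacobi_im_even sqrtN1_prim.
move: norm root m4 ev; rewrite (card_Fp p_pr).
set A := jacobi_re f; set B := jacobi_im f => norm root m4 ev.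
have p0 : 0 < p%:Z :> int by rewrite ltz_nat prime_gt0.
have /dvdzP[k ek] : (p%:Z %| alpha * A + x%:Z * B)%Z.
  rewrite -Fp_int_eq0 // rmorphD !rmorphM /=; apply/eqP.
  transitivity (alpha%:~R * (A%:~R + B%:~R * f) : 'F_p); last by rewrite root mulr0.
  by rewrite /f /sqrtN1; have := alpha_neq0_Fp => a0; field.
have sq : k ^+ 2 * p%:Z ^+ 2 + (alpha * B - x%:Z * A) ^+ 2 = p%:Z ^+ 2.
  transitivity ((alpha ^+ 2 + x%:Z ^+ 2) * (A ^+ 2 + B ^+ 2)).
    by rewrite -exprMn -ek; ring.
  by rewrite -pE norm; ring.
have kp : k ^+ 2 <= 1.
  rewrite -(ler_pM2r (exprn_gt0 2 p0)) mul1r -[leRHS]sq lerDl; exact: sqr_ge0.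
have k0 : k != 0.
  apply/eqP=> k0; move: ek; rewrite k0 mul0r => ek.
  case/dvdzP: alpha1 => a ea; case/dvdzP: ev => b eb.
  have [k' [pk _]] := sqsum_mod4.
  case/dvdzP: m4 => c ec.
  have [m eA] : exists m, A = 2 * m + 1.
    exists (2 * c - b - 2 * k'%:Z - 1); move: ec; rewrite eb -/p pk PoszD PoszM; lia.
  have : 2 * (4 * a * m + 2 * a + m + x%:Z * b) + 1 = 0.
    by rewrite -ek eb eA (_ : alpha = 4 * a + 1); [ring|rewrite mulrC -ea subrK].
  by move: (_ + x%:Z * b) => t; clear; lia.
have k1 := sqr_le1_unit k0 kp.
have k2 : k ^+ 2 = 1 by case: k1 => ->.
have eB : alpha * B = x%:Z * A.
  move: sq; rewrite k2 mul1r => /eqP; rewrite -subr_eq0 addrAC subrr add0r.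
  by rewrite sqrf_eq0 subr_eq0 => /eqP.
have eA' : A = k * alpha.
  apply: (mulfI (lt0r_neq0 p0)).
  transitivity (alpha * (alpha * A + x%:Z * B) + x%:Z * (x%:Z * A - alpha * B)).
    by rewrite pE; ring.
  by rewrite ek eB; ring.
have eB' : B = k * x%:Z.
  apply: (mulfI (lt0r_neq0 p0)).
  transitivity (x%:Z * (alpha * A + x%:Z * B) - alpha * (x%:Z * A - alpha * B)).
    by rewrite pE; ring.
  by rewrite ek eB; ring.
suff <- : k = if (4 %| x)%N then -1 else 1 by [].
have [k' [pk _]] := sqsum_mod4.
case/dvdzP: alpha1 => a ea; case/dvdzP: m4 => c.
rewrite eA' eB' -/p pk (_ : alpha = 4 * a + 1); last by rewrite mulrC -ea subrK.
by move=> e; apply: unit_sign_mod4 x_even e k1.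
Qed.

Lemma qsymM D1 D2 : ~~ (p%:Z %| D1)%Z -> ~~ (p%:Z %| D2)%Z ->
  qsym alpha x (D1 * D2) = qsym alpha x D1 + qsym alpha x D2 %[mod 4].
Proof.
move=> d1 d2; rewrite /qsym rmorphM /=; apply: qlogM; first exact: sqrtN1_prim.
  by rewrite Fp_int_eq0.
by rewrite Fp_int_eq0.
Qed.

Lemma qsymE D e : ~~ (p%:Z %| D)%Z ->
  D%:~R ^+ (p.-1 %/ 4) = f ^+ e -> qsym alpha x D = e %[mod 4].
Proof.
move=> d De; apply: qlogE; rewrite ?card_Fp //; first exact: sqrtN1_prim.
by rewrite Fp_int_eq0.
Qed.

Lemma qsymN1 : qsym alpha x (-1) = x %[mod 4].
Proof.
have [k [pk xk]] := sqsum_mod4.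
rewrite xk; apply: qsymE.
  by rewrite -Fp_int_eq0 // rmorphN1 oppr_eq0 oner_eq0.
rewrite pk addn1 mulKn // exprM (sqrtN1_sqr : f ^+ 2 = _).
by rewrite rmorphN1.
Qed.

End TwoSquares.

(** * Traces of Frobenius *)

Section SquareCount.

Variables (F : finFieldType) (f : F).
Hypothesis f_prim : 4.-primitive_root f.

(** The quartic character of a square is the quadratic character of its root,
    whichever square root of -1 gives the values. *)
Lemma qchar_sqr (K : fieldType) (w : K) (t : F) : w ^+ 2 = -1 ->
  qchar f w (t ^+ 2) = qchar f (-1) t.
Proof.
move=> w2; have w4 := sqrN1_expr4 w2.
by rewrite expr2 qcharM // qchar_mul -expr2 w2.
Qed.

(** A nonzero element is a square exactly when its exponent to the base of a
    generator is even, that is when its quadratic character is 1. *)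
Lemma card_sqrt (c : F) :
  (\sum_(y : F) (y ^+ 2 == c))%:Z = 1 + qchar f (-1 : int) c.
Proof.
have f2 := qprim_sqr f_prim.
have n11 : (1 : F) != -1.
  by rewrite -f2 eq_sym -(prim_order_dvd f_prim).
case: (eqVneq c 0) => [->|c0].
  rewrite qchar0 addr0 (bigD1 0) //= expr0n eqxx big1 // => y y0.
  by rewrite sqrf_eq0 (negPf y0).
case: (pickP (fun y : F => y ^+ 2 == c)) => [y /eqP yc|no]; last first.
  rewrite big1 => [|y _]; last by rewrite no.
  have [g [g_prim g0 g_odd]] := ex_generator f_prim.
  have [j cj] := prim_rootP g_prim (expf_pred_card c0).
  have oj : odd j.
    apply/negP => /negP/even_halfK ej; have := no (g ^+ j./2).
    by rewrite -exprM muln2 ej cj eqxx.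
  have qc := qlogX f_prim j g0; rewrite -cj in qc.
  rewrite /qchar (negPf c0) -signr_odd.
  have -> : odd (qlog f c) by have := congr1 odd qc; rewrite !odd_mod // oddM oj g_odd.
  by [].
have y0 : y != 0 by apply: contraNneq c0 => y0; rewrite -yc y0 expr0n.
have yN : - y != y.
  rewrite -subr_eq0 -opprD oppr_eq0 -mulr2n -mulr_natl mulf_eq0 (negPf y0) orbF.
  by rewrite -addr_eq0 in n11.
rewrite (bigD1 y) // (bigD1 (- y)) //= sqrrN yc eqxx big1 => [|z].
  have qc := qlogX f_prim 2 y0; rewrite yc in qc.
  rewrite /qchar (negPf c0) -signr_odd.
  have -> : odd (qlog f c) = false.
    by have := congr1 odd qc; rewrite !odd_mod // oddM.
  by [].
move=> /andP[z1 z2]; rewrite -yc eqf_sqr; by rewrite (negPf z1) (negPf z2).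
Qed.

End SquareCount.

Lemma card_curve_points (D : int) (p : nat) (f : 'F_p) : prime p ->
  4.-primitive_root f ->
  #|curve_points D p|%:Z =
  1 + p%:Z + \sum_(x : 'F_p) qchar f (-1 : int) (x ^+ 3 + D%:~R * x).
Proof.
move=> p_pr f_prim.
rewrite (cardD1 None) PoszD; rewrite [(None \in _)](_ : _ = true) //.
rewrite -addrA; congr (_ + _).
have <- : #|[set Some P | P in [pred P : 'F_p * 'F_p | P.2 ^+ 2 == P.1 ^+ 3 + D%:~R * P.1]]|
   = #|[predD1 curve_points D p & None]|.
  apply: eq_card => -[[x y]|]; rewrite !inE /=.
    by apply/imsetP/idP => [[[x' y'] PP [-> ->]]|h]; [exact: PP|exists (x, y)].
  by apply/imsetP => -[].
rewrite card_imset; last by move=> ? ? [].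
rewrite -sum1_card big_mkcond /=.
transitivity (\sum_(x : 'F_p) (\sum_(y : 'F_p) (y ^+ 2 == x ^+ 3 + D%:~R * x)%R)%:Z).
  rewrite -(pair_bigA _ (fun x y : 'F_p =>
    if y ^+ 2 == x ^+ 3 + D%:~R * x then 1%N else 0%N)) /=.
  rewrite -[LHS]natz natr_sum; apply: eq_bigr => x _; rewrite natz; congr Posz.
transitivity (\sum_(x : 'F_p) (1 + qchar f (-1 : int) (x ^+ 3 + D%:~R * x))).
  by apply: eq_bigr => x _; apply: (card_sqrt f_prim).
by rewrite big_split /= sumr_const card_Fp // natz.
Qed.

(** Here [a + b * i] is the Gaussian prime, [k] the sign relating it to the Jacobi
    sum, and [i ^ e] the quartic symbol: the left-hand side is minus a trace in
    the Gaussian integers. *)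
Lemma twisted_trace (K : comNzRingType) (a b i k : K) (e : nat) :
  i ^+ 2 = -1 -> k ^+ 2 = 1 -> (e < 4)%N ->
  - k * ((- i) ^+ e * (k * a + k * b * i) + i ^+ e * (k * a - k * b * i)) =
  - (2 * nth 0 [:: a; b; - a; - b] e).
Proof.
move=> i2 k2; case: e => [|[|[|[|//]]]] _ /=.
- by transitivity (- (k ^+ 2) * (2 * a)); [ring|rewrite k2; ring].
- by transitivity (k ^+ 2 * i ^+ 2 * (2 * b)); [ring|rewrite i2 k2; ring].
- by transitivity (- (k ^+ 2 * i ^+ 2 * (2 * a))); [ring|rewrite i2 k2; ring].
- by transitivity (k ^+ 2 * (i ^+ 2) ^+ 2 * (2 * b)); [ring|rewrite i2 k2; ring].
Qed.

Section TraceOfFrobenius.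

Variables (alpha : int) (x : nat).
Hypotheses (alpha1 : (4 %| alpha - 1)%Z) (x_even : ~~ odd x).
Hypothesis p_pr : prime (sqsum alpha x).

Let p := sqsum alpha x.
Let f := sqrtN1 alpha x.

(** The cubic sum counting the points is turned into Jacobi sums by the
    substitution [t = y ^ 2], since the quadratic character of [y] is the quartic
    character of [y ^ 2]. *)
Lemma sum_cubic_jacobi (D : int) : ~~ (p%:Z %| D)%Z ->
  (\sum_(y : 'F_p) qchar f (-1 : int) (y ^+ 3 + D%:~R * y))%:~R =
  qchar f ('i : algC) (-1) *
  (qchar f (- 'i) D%:~R * ((jacobi_re f)%:~R + (jacobi_im f)%:~R * 'i) +
   qchar f 'i D%:~R * ((jacobi_re f)%:~R - (jacobi_im f)%:~R * 'i)).
Proof.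
move=> pD; have f_prim : 4.-primitive_root f by exact: sqrtN1_prim.
have i2 : ('i : algC) ^+ 2 = -1 by exact: sqrCi.
have Ni2 : (- 'i : algC) ^+ 2 = -1 by rewrite sqrrN.
have i4 := sqrN1_expr4 i2; have Ni4 := sqrN1_expr4 Ni2.
set d : 'F_p := D%:~R; have d0 : d != 0 by rewrite /d Fp_int_eq0.
pose s := qchar f (-1 : algC); pose c := qchar f ('i : algC).
pose cb := qchar f (- 'i : algC).
have sM : {morph s : a b / a * b} by apply: qcharM => //; exact: sqrN1_4.
transitivity (\sum_(y : 'F_p) c (y ^+ 2) * s (y ^+ 2 + d)).
  rewrite rmorph_sum /=; apply: eq_bigr => y _.
  rewrite -qchar_int -/s /c (qchar_sqr f_prim) // -/s -sM; congr s; ring.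
transitivity (\sum_(t : 'F_p) (c t + cb t) * s (t + d)).
  rewrite (partition_big (fun y : 'F_p => y ^+ 2) xpredT) //=.
  apply: eq_bigr => t _.
  transitivity ((\sum_(y : 'F_p) (y ^+ 2 == t)%R)%:R * (c t * s (t + d))).
    rewrite natr_sum mulr_suml big_mkcond /=; apply: eq_bigr => y _.
    by case: eqP => [->|_]; rewrite ?mul1r ?mul0r.
  rewrite -[_%:R]/((Posz _)%:~R) (card_sqrt f_prim) rmorphD rmorph1 /= -qchar_int.
  rewrite mulrDl mul1r mulrDl; congr (_ + _); rewrite mulrA; congr (_ * _).
  by rewrite /c qchar_mul mulN1r.
have Nd0 : - d != 0 by rewrite oppr_eq0.
have cN1 : cb (-1) = c (-1).
  rewrite /c /cb /qchar oppr_eq0 oner_eq0 exprNn -signr_odd.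
  by rewrite (negPf (qlogN1_even f_prim)) mul1r.
have half (w : algC) : w ^+ 4 = 1 ->
    \sum_(t : 'F_p) qchar f w t * s (t + d) =
    qchar f w (-1) * qchar f (- w) d * jacobi_sum (qchar f w) s.
  move=> w4; rewrite -(sum_scale _ Nd0) /jacobi_sum mulr_sumr.
  apply: eq_bigr => u _.
  have -> : - d * u + d = d * (1 - u) by ring.
  have -> : - d * u = (-1) * (d * u) by ring.
  rewrite sM !(qcharM f_prim w4) -[- w]mulrN1 -qchar_mul -/s.
  move: (qchar f w (-1)) (qchar f w d) (qchar f w u) (s d) (s (1 - u)) => a1 a2 a3 a4 a5.
  ring.
under eq_bigr do rewrite mulrDl.
rewrite big_split /= half // half // opprK -/c -/cb cN1.
rewrite (jacobi_sumE f i2) (jacobi_sumE f Ni2).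
by rewrite mulrN [RHS]mulrDr !mulrA.
Qed.

Lemma qsym_lt4 D : (qsym alpha x D < 4)%N.
Proof. exact: qlog_lt4. Qed.

(** The signs of the quartic character at -1 and of the Jacobi sum are opposite,
    which leaves the trace of [alpha + i x] multiplied by the conjugate of the
    symbol. *)
Theorem trace_frob_qsym (D : int) : ~~ (p%:Z %| D)%Z ->
  trace_frob D p =
  2 * nth 0 [:: alpha; x%:Z; - alpha; - x%:Z] (qsym alpha x D).
Proof.
move=> pD; have f_prim : 4.-primitive_root f by exact: sqrtN1_prim.
have i2 : ('i : algC) ^+ 2 = -1 by exact: sqrCi.
rewrite /trace_frob (card_curve_points D p_pr f_prim).
rewrite -/p opprD addrA subrr add0r; apply/eqP; rewrite eqr_oppLR -(eqr_int algC).
rewrite sum_cubic_jacobi //; have [-> ->] := jacobi_eq alpha1 x_even p_pr.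
rewrite -/f.
have N1 : (-1 : 'F_p) != 0 by rewrite oppr_eq0 oner_eq0.
have -> : qchar f 'i (-1) = - (if (4 %| x)%N then -1 else 1 : int)%:~R :> algC.
  rewrite /qchar (negPf N1).
  have : qlog f (-1) = x %[mod 4].
    by have := qsymN1 alpha1 x_even p_pr; rewrite /qsym rmorphN1.
  rewrite modn_small ?qlog_lt4 // => ->.
  have : (x %% 4 = if (4 %| x)%N then 0 else 2)%N by case: ifP; lia.
  by case: ifP => _ ->; rewrite ?i2 ?opprK.
rewrite {1 2}/qchar Fp_int_eq0 // (negPf pD) -/(qsym alpha x D).
set k := (X in - X%:~R); have k1 : k%:~R ^+ 2 = 1 :> algC.
  by rewrite /k; case: ifP => _; rewrite ?rmorphN1 ?sqrrN ?rmorph1 expr1n.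
rewrite !rmorphM /= -/k.
rewrite -pmulrn (twisted_trace _ _ i2 k1 (qsym_lt4 D)) rmorphN rmorphM /=.
have := qsym_lt4 D; case: (qsym alpha x D) => [|[|[|[|//]]]] _ //=.
  by rewrite rmorphN.
by rewrite rmorphN.
Qed.

End TraceOfFrobenius.

(** * Quartic reciprocity for rational primes *)

Lemma closed_field_of_pchar (q : nat) : prime q ->
  exists K : closedFieldType, q \in [pchar K].
Proof.
move=> q_pr; have [K [h _]] := countable_algebraic_closure 'F_q.
by exists K; apply: (rmorph_pchar h); apply: pchar_Fp.
Qed.

Section FrobeniusGauss.

Variables (F : finFieldType) (f : F) (K : fieldType) (w : K) (psi : F -> K).
Variable q : nat.
Hypotheses (f_prim : 4.-primitive_root f) (w2 : w ^+ 2 = -1).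
Hypotheses (psiP : addchar psi) (qK : q \in [pchar K]) (q_odd : odd q).
Hypotheses (N_neq0 : #|F|%:R != 0 :> K) (qF_neq0 : q%:R != 0 :> F).

Let J := (jacobi_re f)%:~R + (jacobi_im f)%:~R * w.
Let w4 : w ^+ 4 = 1. Proof. exact: sqrN1_expr4. Qed.

Lemma two_neq0_pchar : 2%:R != 0 :> K.
Proof.
rewrite -(dvdn_pcharf qK) dvdn_prime2 ?(pcharf_prime qK) //.
by apply/eqP=> q2; move: q_odd; rewrite q2.
Qed.

Lemma addchar_mulrn (t : F) n : psi (t *+ n) = psi t ^+ n.
Proof.
case: psiP => psi0 psiD _; elim: n => [|n IH]; first by rewrite mulr0n psi0.
by rewrite mulrS psiD IH exprS.
Qed.

(** Raising to the power [q] is additive in characteristic [q], so it only twists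
    the characters of a Gauss sum. *)
Lemma gauss_sum_frobenius (v : K) : v ^+ 4 = 1 ->
  gauss_sum psi (qchar f v) ^+ q =
  (qchar f (v ^+ q) q%:R)^-1 * gauss_sum psi (qchar f (v ^+ q)).
Proof.
move=> v4; have vq4 : (v ^+ q) ^+ 4 = 1 by rewrite exprAC v4 expr1n.
rewrite -(gauss_sum_scale psi (qchar_mulchar f_prim vq4) qF_neq0).
rewrite -(pFrobenius_autE qK) rmorph_sum /=; apply: eq_bigr => t _.
rewrite pFrobenius_autE exprMn -qchar_expr ?prime_gt0 ?(pcharf_prime qK) //.
by rewrite mulr_natl addchar_mulrn.
Qed.

Lemma qchar_nat_neq0 (v : K) : v ^+ 4 = 1 -> qchar f v q%:R != 0.
Proof. by move=> v4; apply: mulchar_neq0 => //; apply: qchar_mulchar. Qed.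

(** For [q] congruent to 1 modulo 4 the power [q] preserves the quartic character,
    so that [G ^ (q - 1)] is the inverse of its value at [q]. *)
Lemma quartic_law1 : (q %% 4 = 1)%N ->
  (J ^+ 2 * #|F|%:R) ^+ (q %/ 4) * qchar f w q%:R = 1.
Proof.
move=> q1; have two0 := two_neq0_pchar.
have wq : w ^+ q = w by rewrite -(expr_mod _ w4) q1.
have := gauss_sum_frobenius w4; rewrite wq.
have G0 := gauss_neq0 f_prim w2 two0 psiP N_neq0.
rewrite -(gauss_expr4 f_prim w2 two0 psiP N_neq0) -exprM.
rewrite {1}(divn_eq q 4) q1 addn1 exprSr => /(mulIf G0).
by rewrite mulnC => ->; rewrite mulVf // qchar_nat_neq0.
Qed.

(** For [q] congruent to 3 modulo 4 the power [q] exchanges the quartic character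
    and its conjugate, and [G * Gbar] is known. *)
Lemma quartic_law3 : (q %% 4 = 3)%N ->
  (J ^+ 2 * #|F|%:R) ^+ (q %/ 4).+1 = qchar f w q%:R * qchar f w (-1) * #|F|%:R.
Proof.
move=> q3; have two0 := two_neq0_pchar.
have wq : w ^+ q = - w.
  by rewrite -(expr_mod _ w4) q3 exprSr w2 mulN1r.
have := gauss_sum_frobenius w4; rewrite wq => e.
rewrite -(gauss_expr4 f_prim w2 two0 psiP N_neq0) -exprM.
have -> : (4 * (q %/ 4).+1 = q.+1)%N by rewrite {2}(divn_eq q 4) q3; lia.
rewrite exprSr e mulrAC -mulrA.
rewrite (gauss_mul_bar f_prim w2 two0 psiP) mulrA; congr (_ * _ * _).
have c0 := qchar_nat_neq0 (sqrN1_expr4 (etrans (sqrrN w) w2)).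
by apply: (mulIf c0); rewrite mulVf // qchar_mulN.
Qed.

Lemma quadratic_law : #|F|%:R ^+ q./2 * qchar f (-1 : K) q%:R = 1.
Proof.
have two0 := two_neq0_pchar; have N4 := sqrN1_4 K.
have := gauss_sum_frobenius N4.
have -> : (-1) ^+ q = -1 :> K by rewrite -signr_odd q_odd.
have sq := gauss_quadratic_sqr f_prim two0 psiP.
have G0 : gauss_sum psi (qchar f (-1 : K)) != 0.
  by apply: contraNneq N_neq0 => G0; rewrite -sq G0 mul0r.
rewrite -{1}(odd_double_half q) q_odd add1n exprSr => /(mulIf G0).
rewrite -mul2n exprM expr2 sq => ->.
by rewrite mulVf // qchar_nat_neq0.
Qed.

End FrobeniusGauss.

Definition two_square_prime (alpha : int) (x : nat) : bool :=
  ~~ odd x && prime (sqsum alpha x).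

Section CharacteristicQ.

Variables (alpha : int) (q : nat).
Hypotheses (alpha1 : (4 %| alpha - 1)%Z) (q_pr : prime q) (q_odd : odd q).

Variables (K : closedFieldType) (w : K).
Hypotheses (qK : q \in [pchar K]) (w2 : w ^+ 2 = -1).

Let pi (x : nat) : K := alpha%:~R + x%:R * w.
Let N (x : nat) : K := alpha%:~R ^+ 2 + x%:R ^+ 2.

Section OnePrime.

Variable x : nat.
Hypotheses (xP : two_square_prime alpha x) (xq : sqsum alpha x != q).

Lemma sqsum_pchar : (sqsum alpha x)%:R = N x.
Proof. by rewrite [LHS]pmulrn sqsumE rmorphD !rmorphXn. Qed.

Lemma sqsum_pchar_neq0 : (sqsum alpha x)%:R != 0 :> K.
Proof.
case/andP: xP => _ p_pr; rewrite -(dvdn_pcharf qK) dvdn_prime2 //.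
by rewrite eq_sym.
Qed.

Lemma Fp_q_neq0 : q%:R != 0 :> 'F_(sqsum alpha x).
Proof. by case/andP: xP => _ p_pr; rewrite Fp_nat_eq0 // dvdn_prime2. Qed.

Lemma sqsum_addchar : exists psi : 'F_(sqsum alpha x) -> K, addchar psi.
Proof.
case/andP: xP => _ p_pr.
have [z zp z1] := ex_unity_root p_pr sqsum_pchar_neq0.
by exists (fun t => z ^+ t); apply: addchar_Fp.
Qed.

Lemma jacobi_sqr_pchar :
  ((jacobi_re (sqrtN1 alpha x))%:~R + (jacobi_im (sqrtN1 alpha x))%:~R * w) ^+ 2
  = pi x ^+ 2.
Proof.
case/andP: xP => x_even p_pr; have [-> ->] := jacobi_eq alpha1 x_even p_pr.
rewrite !rmorphM /= -mulrA -mulrDr exprMn -pmulrn -/(pi x).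
by case: ifP => _; rewrite ?rmorphN1 ?sqrrN ?rmorph1 expr1n mul1r.
Qed.

Lemma qchar_qsym (v : K) :
  qchar (sqrtN1 alpha x) v q%:R = v ^+ qsym alpha x q%:Z.
Proof. by rewrite /qchar (negPf Fp_q_neq0) /qsym -pmulrn. Qed.

Lemma qsym_law1 : (q %% 4 = 1)%N ->
  (pi x ^+ 2 * N x) ^+ (q %/ 4) * w ^+ qsym alpha x q%:Z = 1.
Proof.
move=> q1; case/andP: (xP) => x_even p_pr; have [psi psiP] := sqsum_addchar.
have := quartic_law1 (sqrtN1_prim alpha1 x_even p_pr) w2 psiP qK q_odd.
rewrite card_Fp // => /(_ sqsum_pchar_neq0 Fp_q_neq0 q1).
by rewrite jacobi_sqr_pchar sqsum_pchar qchar_qsym.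
Qed.

Lemma qsym_law3 : (q %% 4 = 3)%N ->
  (pi x ^+ 2 * N x) ^+ (q %/ 4).+1 = w ^+ (qsym alpha x q%:Z + x) * N x.
Proof.
move=> q3; case/andP: (xP) => x_even p_pr; have [psi psiP] := sqsum_addchar.
have := quartic_law3 (sqrtN1_prim alpha1 x_even p_pr) w2 psiP qK q_odd.
rewrite card_Fp // => /(_ sqsum_pchar_neq0 Fp_q_neq0 q3).
rewrite jacobi_sqr_pchar sqsum_pchar qchar_qsym => ->.
rewrite exprD; congr (_ * _ * _).
rewrite /qchar oppr_eq0 oner_eq0 /=.
apply: (expr_mod4 (sqrN1_expr4 w2)).
by have := qsymN1 alpha1 x_even p_pr; rewrite /qsym rmorphN1.
Qed.

Lemma qsym_quadratic_law : N x ^+ q./2 = (-1) ^+ qsym alpha x q%:Z.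
Proof.
case/andP: (xP) => x_even p_pr; have [psi psiP] := sqsum_addchar.
have := quadratic_law (sqrtN1_prim alpha1 x_even p_pr) psiP qK q_odd.
rewrite card_Fp // => /(_ sqsum_pchar_neq0 Fp_q_neq0).
rewrite sqsum_pchar qchar_qsym => e.
apply: (@mulIf _ ((-1) ^+ qsym alpha x q%:Z)); first by rewrite signr_eq0.
by rewrite e -expr2 sqrr_sign.
Qed.

End OnePrime.

End CharacteristicQ.

Lemma ex_sqrtN1 (K : closedFieldType) : exists w : K, w ^+ 2 = -1.
Proof.
have [w] := @solve_monicpoly K 2%N (fun i => if i == 0%N then -1 else 0) isT.
by rewrite !big_ord_recl big_ord0 /= mul0r !addr0 mulr1 => w2; exists w.
Qed.

(** The quartic symbol of an odd prime [q] is determined by the image of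
    [alpha + i x] in characteristic [q], up to the symbol of -1. *)
Lemma qsym_prime_shift (alpha : int) (q : nat) :
    (4 %| alpha - 1)%Z -> prime q -> odd q ->
  exists c : nat, forall x1 x2 : nat,
    two_square_prime alpha x1 -> two_square_prime alpha x2 ->
    sqsum alpha x1 != q -> sqsum alpha x2 != q -> x1 = x2 %[mod q] ->
    qsym alpha x1 q%:Z + c * x1 = qsym alpha x2 q%:Z + c * x2 %[mod 4].
Proof.
move=> alpha1 q_pr q_odd; have [K qK] := closed_field_of_pchar q_pr.
have [w w2] := ex_sqrtN1 K.
have w_prim := sqrN1_prim (two_neq0_pchar qK q_odd) w2.
have [q1|q3] : (q %% 4 = 1)%N \/ (q %% 4 = 3)%N by lia.
  exists 0%N => x1 x2 P1 P2 n1 n2 e12; rewrite !mul0n !addn0.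
  have eK : x1%:R = x2%:R :> K.
    by rewrite -(GRing.natr_mod_pchar qK) e12 (GRing.natr_mod_pchar qK).
  have l1 := qsym_law1 alpha1 q_pr q_odd qK w2 P1 n1 q1.
  have l2 := qsym_law1 alpha1 q_pr q_odd qK w2 P2 n2 q1.
  rewrite eK in l1; apply/eqP; rewrite -(eq_prim_root_expr w_prim).
  set C := (_ ^+ (q %/ 4) : K) in l1 l2.
  have C0 : C != 0.
    by apply/eqP=> C0; move: l1; rewrite C0 mul0r => /esym/eqP; rewrite oner_eq0.
  by apply/eqP/(mulfI C0); rewrite l1 l2.
exists 1%N => x1 x2 P1 P2 n1 n2 e12; rewrite !mul1n.
have eK : x1%:R = x2%:R :> K.
  by rewrite -(GRing.natr_mod_pchar qK) e12 (GRing.natr_mod_pchar qK).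
have l1 := qsym_law3 alpha1 q_pr q_odd qK w2 P1 n1 q3.
have l2 := qsym_law3 alpha1 q_pr q_odd qK w2 P2 n2 q3.
have N0 := sqsum_pchar_neq0 q_pr qK P2 n2; rewrite sqsum_pchar in N0.
rewrite eK l2 in l1; apply/eqP; rewrite -(eq_prim_root_expr w_prim).
by apply/eqP/(mulIf N0).
Qed.

(** * The quartic symbol of 2 *)

(** For an odd prime [n] this is the condition for 2 not to be a square modulo
    [n]. *)
Definition is35mod8 (n : nat) : bool := (n %% 8 == 3)%N || (n %% 8 == 5)%N.

Lemma is35mod8M a b : odd a -> odd b ->
  is35mod8 (a * b) = is35mod8 a (+) is35mod8 b.
Proof.
move=> oa ob; rewrite /is35mod8 -modnMm.
have : odd (a %% 8) by rewrite odd_mod.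
have : odd (b %% 8) by rewrite odd_mod.
have := ltn_pmod a (isT : 0 < 8)%N; have := ltn_pmod b (isT : 0 < 8)%N.
case: (a %% 8)%N => [|[|[|[|[|[|[|[|//]]]]]]]] //;
  by case: (b %% 8)%N => [|[|[|[|[|[|[|[|//]]]]]]]].
Qed.

(** With [z] a primitive eighth root of unity, [z - z ^ 3 = z + z^-1] is a square
    root of 2, which raising to the power [q] fixes or changes to its opposite. *)
Lemma two_pow_half (q : nat) (K : closedFieldType) :
  prime q -> odd q -> q \in [pchar K] ->
  2%:R ^+ q./2 = (-1) ^+ is35mod8 q :> K.
Proof.
move=> q_pr q_odd qK.
have [z] := @solve_monicpoly K 4%N (fun i => if i == 0%N then -1 else 0) isT.
rewrite !big_ord_recl big_ord0 /= !mul0r !addr0 expr0 mulr1 => z4.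
have z0 : z != 0.
  by apply/eqP=> z0; move: z4; rewrite z0 expr0n => /eqP; rewrite eq_sym oppr_eq0 oner_eq0.
have z8 : z ^+ 8 = 1 by rewrite (exprM z 4 2) z4 sqrrN expr1n.
pose tau := z - z ^+ 3.
have tau2 : tau ^+ 2 = 2%:R.
  have -> : tau ^+ 2 = z ^+ 2 * (1 + z ^+ 4) - 2%:R * z ^+ 4 by rewrite /tau; ring.
  by rewrite z4; ring.
have two0 : 2%:R != 0 :> K by exact: two_neq0_pchar qK q_odd.
have tau0 : tau != 0 by apply: contraNneq two0 => t0; rewrite -tau2 t0 expr0n.
apply: (mulIf tau0).
have -> : 2%:R ^+ q./2 * tau = tau ^+ q.
  by rewrite -[in RHS](odd_double_half q) q_odd add1n exprSr -mul2n exprM tau2.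
rewrite -(pFrobenius_autE qK) /tau rmorphB rmorphXn /= pFrobenius_autE.
have zq : z ^+ q = z ^+ (q %% 8) by rewrite expr_mod.
rewrite zq /is35mod8.
have : odd (q %% 8) by rewrite odd_mod.
have := ltn_pmod q (isT : 0 < 8)%N.
have z5 : z ^+ 5 = - z by rewrite exprSr z4 mulN1r.
case: (q %% 8)%N => [|[|[|[|[|[|[|[|//]]]]]]]] //= _ _.
- by rewrite expr1 mul1r.
- by rewrite -exprM (exprD z 8 1) z8; ring.
- by rewrite z5; ring.
- have -> : z ^+ 7 = - z ^+ 3 by rewrite (exprD z 4 3) z4 mulN1r.
  have -> : (- z ^+ 3) ^+ 3 = - (z ^+ 8 * z) by ring.
  by rewrite z8; ring.
Qed.

Lemma odd_mod4 a b : a = b %[mod 4] -> odd a = odd b.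
Proof. by move=> /(congr1 odd); rewrite !odd_mod. Qed.

Lemma odd_mod4_even a b c d : a = b + c %[mod 4] -> b = d %[mod 4] ->
  ~~ odd d -> odd c = odd a.
Proof.
by move=> /odd_mod4 -> /odd_mod4 bd /negPf d_even; rewrite oddD bd d_even.
Qed.

Section SymbolParity.

Variables (alpha : int) (x : nat).
Hypotheses (alpha1 : (4 %| alpha - 1)%Z) (xP : two_square_prime alpha x).

Let p := sqsum alpha x.

Let x_even : ~~ odd x. Proof. by case/andP: xP. Qed.
Let p_pr : prime p. Proof. by case/andP: xP. Qed.

Lemma qsym1 : qsym alpha x 1 = 0%N.
Proof. by rewrite /qsym qlog1 // sqrtN1_prim. Qed.

(** A quadratic character agrees with an additive condition on odd numbers as soon
    as it does so on their prime factors: this replaces the Jacobi symbol. *)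
Lemma qsym_odd_nat (h : nat -> bool) : h 1%N = false ->
  (forall a b, odd a -> odd b -> h (a * b)%N = h a (+) h b) ->
  forall n : nat, odd n -> ~~ (p %| n)%N ->
  (forall q, prime q -> (q %| n)%N -> odd (qsym alpha x q%:Z) = h q) ->
  odd (qsym alpha x n%:Z) = h n.
Proof.
move=> h1 hM; elim/ltn_ind => n IH n_odd pn hq.
have [n1|n1] := leqP n 1.
  have -> : n = 1%N by case: n n_odd n1 {IH pn hq} => [|[]].
  by rewrite h1 qsym1.
have q_pr := pdiv_prime n1; have qn := pdiv_dvd n.
move: qn; set q := pdiv n in q_pr *; move=> /dvdnP[m nE].
have [m_odd q_odd] : odd m /\ odd q by move: n_odd; rewrite nE oddM => /andP[].
have pm : ~~ (p %| m)%N by apply: contra pn; rewrite nE; apply: dvdn_mulr.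
have pq : ~~ (p %| q)%N by apply: contra pn; rewrite nE; apply: dvdn_mull.
have e := qsymM alpha1 x_even p_pr (D1 := m%:Z) (D2 := q%:Z) pm pq.
have hm : odd (qsym alpha x m%:Z) = h m.
  apply: (IH m _ m_odd pm); first by rewrite nE ltn_Pmulr ?prime_gt1 ?odd_gt0.
  by move=> r r_pr rm; apply: hq => //; rewrite nE dvdn_mulr.
have hqq : odd (qsym alpha x q%:Z) = h q by apply: hq => //; rewrite nE dvdn_mull.
rewrite nE hM // -hm -hqq -oddD; exact: odd_mod4 e.
Qed.

(** The exponent of -1 is congruent to the even number [x]: -1 is a square modulo
    [p]. *)
Lemma qsym_odd_abs (D : int) : ~~ (p%:Z %| D)%Z ->
  odd (qsym alpha x D) = odd (qsym alpha x `|D|%N%:Z).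
Proof.
move=> pD; have [D0|D0] := leP 0 D; first by rewrite gez0_abs.
rewrite (ltz0_abs D0) -mulN1r.
have N1 : ~~ (p%:Z %| -1)%Z.
  by rewrite dvdzE /= dvdn1; have := prime_gt1 p_pr; case: p => [|[]].
exact: odd_mod4_even (qsymM alpha1 x_even p_pr N1 pD)
  (qsymN1 alpha1 x_even p_pr) x_even.
Qed.

(** Quadratic reciprocity for [q] and [p = alpha ^ 2 + x ^ 2], when [p] is a square
    or twice a square modulo [q]. *)
Lemma qsym_odd_prime (q : nat) (y : int) (b : bool) : prime q -> odd q -> p != q ->
  ~~ (q%:Z %| y)%Z ->
  (q%:Z %| alpha ^+ 2 + x%:Z ^+ 2 - (if b then 2 else 1) * y ^+ 2)%Z ->
  odd (qsym alpha x q%:Z) = b && is35mod8 q.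
Proof.
move=> q_pr q_odd pq qy; have [K qK] := closed_field_of_pchar q_pr.
rewrite (dvdz_pcharf qK) rmorphB rmorphD !rmorphXn /= rmorphM rmorphXn /= subr_eq0.
move=> /eqP eK.
have law := qsym_quadratic_law alpha1 q_pr q_odd qK xP pq.
rewrite -pmulrn in eK; rewrite eK exprMn in law.
have n11 : (1 : K) != -1 by rewrite -addr_eq0; exact: (two_neq0_pchar qK q_odd).
have y1 : (y%:~R ^+ 2) ^+ q./2 = 1 :> K.
  have y0 : y%:~R != 0 :> K by rewrite -(dvdz_pcharf qK).
  apply: (mulIf y0); rewrite mul1r -exprM mul2n -exprSr.
  have -> : (q./2.*2.+1 = q)%N by rewrite -{2}(odd_double_half q) q_odd.
  by rewrite -(pFrobenius_autE qK) pFrobenius_aut_int.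
rewrite y1 mulr1 in law.
have : (-1) ^+ (odd (qsym alpha x q%:Z)) = (-1) ^+ (b && is35mod8 q) :> K.
  rewrite signr_odd -law; case: b {eK law} => /=; last by rewrite expr1n.
  exact: two_pow_half.
case: odd (b && _) => -[] //= /eqP; by rewrite ?(negPf n11) // eq_sym (negPf n11).
Qed.

Lemma odd_dvd (q n : nat) : odd n -> (q %| n)%N -> odd q.
Proof. by move=> n_odd /dvdnP[k nE]; move: n_odd; rewrite nE oddM => /andP[]. Qed.

(** Modulo a prime factor of [alpha], the prime [p] is the square of [x]. *)
Lemma qsym_alpha_even : ~~ odd (qsym alpha x alpha).
Proof.
have pa : ~~ (p%:Z %| alpha)%Z by exact: sqsum_ndvd_alpha.
rewrite qsym_odd_abs //; apply/negbT.
apply: (qsym_odd_nat (h := fun=> false)) => //; first by case/dvdzP: alpha1; lia.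
move=> q q_pr qa; have q_odd : odd q by apply: odd_dvd qa; case/dvdzP: alpha1; lia.
have qaZ : (q%:Z %| alpha)%Z by [].
have pq : p != q by apply: contraNneq pa => ->.
rewrite (@qsym_odd_prime q x%:Z false) //.
  apply/negP => qx; have : (q %| p)%N.
    rewrite -[(_ %| _)%N]/(q%:Z %| p%:Z)%Z sqsumE //.
    by rewrite rpredD // expr2 dvdz_mulr.
  by rewrite dvdn_prime2 // eq_sym (negPf pq).
by rewrite mul1r addrK expr2 dvdz_mulr.
Qed.

Lemma sqsum_ndvd_x : ~~ (p%:Z %| x%:Z)%Z.
Proof.
apply/negP => px; have : (p%:Z %| alpha ^+ 2)%Z.
  have -> : alpha ^+ 2 = p%:Z - x%:Z ^+ 2 by rewrite sqsumE // addrK.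
  by rewrite rpredB ?dvdzz // expr2 dvdz_mulr.
rewrite dvdzE abszX /= Euclid_dvdX // => /andP[pa _].
by have := sqsum_ndvd_alpha alpha1 x_even p_pr; rewrite dvdzE pa.
Qed.

Lemma sqsum_ndvd_2 : ~~ (p%:Z %| 2)%Z.
Proof.
rewrite -[(_ %| _)%Z]/(p %| 2)%N dvdn_prime2 //; apply/eqP => p2.
by have := sqsum_odd alpha1 x_even p_pr; rewrite -/p p2.
Qed.

Lemma sqsum_ndvdM (a b : int) : ~~ (p%:Z %| a)%Z -> ~~ (p%:Z %| b)%Z ->
  ~~ (p%:Z %| a * b)%Z.
Proof. by rewrite !dvdzE abszM Euclid_dvdM // negb_or => -> ->. Qed.

Lemma sqsum_sqr_sum : (alpha + x%:Z) ^+ 2 = p%:Z + 2 * alpha * x%:Z.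
Proof. by rewrite sqsumE //; ring. Qed.

Lemma sqsum_ndvd_sum : ~~ (p%:Z %| alpha + x%:Z)%Z.
Proof.
apply/negP => ps; have : (p%:Z %| 2 * alpha * x%:Z)%Z.
  have -> : 2 * alpha * x%:Z = (alpha + x%:Z) ^+ 2 - p%:Z.
    by rewrite sqsum_sqr_sum; ring.
  by rewrite rpredB ?dvdzz // expr2 dvdz_mulr.
apply/negP; apply: sqsum_ndvdM; last exact: sqsum_ndvd_x.
by apply: sqsum_ndvdM; [exact: sqsum_ndvd_2|exact: sqsum_ndvd_alpha].
Qed.

(** Modulo a prime factor of [alpha + x], the prime [p] is twice the square of
    [alpha]. *)
Lemma qsym_sum_parity :
  odd (qsym alpha x (alpha + x%:Z)) = is35mod8 (absz (alpha + x%:Z)).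
Proof.
have ps := sqsum_ndvd_sum; have s_odd : odd (absz (alpha + x%:Z)).
  by case/dvdzP: alpha1 => a ea; lia.
rewrite qsym_odd_abs //; apply: qsym_odd_nat => //; first exact: is35mod8M.
move=> q q_pr qs; have q_odd := odd_dvd s_odd qs.
have qsZ : (q%:Z %| alpha + x%:Z)%Z by [].
have pq : p != q by apply: contraNneq ps => ->.
have ex : x%:Z = (alpha + x%:Z) - alpha by ring.
rewrite (@qsym_odd_prime q alpha true) //.
  apply/negP => qa; have : (q %| p)%N.
    rewrite -[(_ %| _)%N]/(q%:Z %| p%:Z)%Z sqsumE //.
    by rewrite rpredD // expr2 dvdz_mulr // ex rpredB.
  by rewrite dvdn_prime2 // eq_sym (negPf pq).
have -> : alpha ^+ 2 + x%:Z ^+ 2 - 2 * alpha ^+ 2 = (alpha + x%:Z) * (x%:Z - alpha).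
  by ring.
by rewrite dvdz_mulr.
Qed.

End SymbolParity.

(** So [is35mod8 n] is the parity of [(n ^ 2 - 1) / 8], the exponent of -1 in the
    usual formula for the Jacobi symbol of 2. *)
Lemma odd_sqr_mod16 (n : nat) : odd n -> (n ^ 2 = 8 * is35mod8 n + 1 %[mod 16])%N.
Proof.
move=> n_odd; rewrite /is35mod8.
have : odd (n %% 16) by rewrite odd_mod.
have -> : (n %% 8 = (n %% 16) %% 8)%N by rewrite modn_dvdm.
rewrite -modnXm; have := ltn_pmod n (isT : 0 < 16)%N.
by case: (n %% 16)%N => [|[|[|[|[|[|[|[|[|[|[|[|[|[|[|[|m]]]]]]]]]]]]]]]].
Qed.

Lemma pred_div4 k : ((4 * k + 1).-1 %/ 4 = (4 * k + 1) %/ 4)%N.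
Proof. lia. Qed.

Lemma symbol2_sum_arith s sa a a2 tw f p4 ts :
  sa = 2 * s %[mod 4] -> sa = ts + a2 %[mod 4] -> ts = tw + f %[mod 4] ->
  a2 = 2 * a %[mod 4] -> f = p4 %[mod 4] -> ~~ odd a ->
  2 * s = tw + p4 %[mod 4].
Proof. lia. Qed.

Section SymbolOfTwo.

Variables (alpha : int) (x : nat).
Hypotheses (alpha1 : (4 %| alpha - 1)%Z) (xP : two_square_prime alpha x).

Let p := sqsum alpha x.

Let x_even : ~~ odd x. Proof. by case/andP: xP. Qed.
Let p_pr : prime p. Proof. by case/andP: xP. Qed.

(** [(alpha + x) ^ 2] is congruent to [2 * alpha * x], that is to [2 * alpha ^ 2]
    times the square root of -1; this expresses the quartic symbol of 2 by
    quadratic symbols. *)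
Lemma qsym2_sum :
  2 * qsym alpha x (alpha + x%:Z) =
  qsym alpha x 2 + p %/ 4 %[mod 4].
Proof.
have f_prim := sqrtN1_prim alpha1 x_even p_pr.
have pa := sqsum_ndvd_alpha alpha1 x_even p_pr.
have p2 := sqsum_ndvd_2 alpha1 xP; have ps := sqsum_ndvd_sum alpha1 xP.
have nz D : ~~ (p%:Z %| D)%Z -> D%:~R != 0 :> 'F_p by rewrite Fp_int_eq0.
have f0 : sqrtN1 alpha x != 0 by exact: qprim_neq0.
have a0 := nz _ pa; have s0 := nz _ ps; have t0 := nz _ p2.
have pE0 : (p%:Z)%:~R = 0 :> 'F_p by apply/eqP; rewrite Fp_int_eq0 // dvdzz.
have e : ((alpha + x%:Z)%:~R : 'F_p) ^+ 2 =
    2%:~R * sqrtN1 alpha x * (alpha%:~R ^+ 2).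
  rewrite -rmorphXn /= sqsum_sqr_sum // rmorphD /= pE0 add0r !rmorphM /= -pmulrn.
  by rewrite /sqrtN1; field.
have h1 := qlogX f_prim 2 s0; rewrite e in h1.
have h2 := qlogM f_prim (mulf_neq0 t0 f0) (expf_neq0 2 a0).
have h3 := qlogM f_prim t0 f0; have h4 := qlogX f_prim 2 a0.
have h5 : qlog (sqrtN1 alpha x) (sqrtN1 alpha x) = (p %/ 4)%N %[mod 4].
  apply: qlogE => //; rewrite card_Fp // -/p.
  have [k [pk _]] := sqsum_mod4 alpha1 x_even p_pr; congr (_ ^+ _).
  by rewrite /p pk pred_div4.
have ev := qsym_alpha_even alpha1 xP.
exact: symbol2_sum_arith h1 h2 h3 h4 h5 ev.
Qed.

Lemma symbol2_arith (k y o q2 qs : nat) (N t : int) :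
  N = 4 * k%:Z + 1 + 16 * t + 4 * y%:Z -> (N = 8 * o%:Z + 1 %[mod 16])%Z ->
  odd qs = odd o -> 2 * qs = q2 + k %[mod 4] -> q2 = y %[mod 4].
Proof. lia. Qed.

Lemma qsym2 : qsym alpha x 2 = x./2 %[mod 4].
Proof.
have h := qsym2_sum; have par := qsym_sum_parity alpha1 xP.
have [k [pk _]] := sqsum_mod4 alpha1 x_even p_pr.
set n := absz (alpha + x%:Z) in par.
have n_odd : odd n by case/dvdzP: alpha1 => a ea; rewrite /n; lia.
have sq := odd_sqr_mod16 n_odd.
have nE : (n ^ 2)%N%:Z = (alpha + x%:Z) ^+ 2 by rewrite /n -abszX gez0_abs ?sqr_ge0.
case/dvdzP: alpha1 => a ea.
have pd : (p %/ 4 = k)%N by rewrite /p pk; lia.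
rewrite pd in h; rewrite -[is35mod8 n]oddb in par.
apply: (@symbol2_arith k x./2 (is35mod8 n) _ _ (n ^ 2)%N%:Z (a * x./2%:Z) _ _ par h).
  rewrite nE sqsum_sqr_sum // pk -{1}(even_halfK x_even).
  rewrite (_ : alpha = a * 4 + 1); last by rewrite -ea subrK.
  rewrite -mul2n (PoszD (4 * k)) !PoszM; ring.
by move: sq; move: (n ^ 2)%N (is35mod8 n : nat) => N b; lia.
Qed.

End SymbolOfTwo.

(** * Variation of the quartic symbol with x *)

Lemma eqmod_dvd (m n a b : nat) : (m %| n)%N -> a = b %[mod n] -> a = b %[mod m].
Proof. by move=> mn e; rewrite -(modn_dvdm a mn) e modn_dvdm. Qed.

Lemma shift_arith n1 n2 m1 m2 q1 q2 c1 c2 d1 d2 :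
  m1 + c1 = m2 + c2 %[mod 4] -> q1 + d1 = q2 + d2 %[mod 4] ->
  n1 = m1 + q1 %[mod 4] -> n2 = m2 + q2 %[mod 4] ->
  n1 + (c1 + d1) = n2 + (c2 + d2) %[mod 4].
Proof. lia. Qed.

Section Shift.

Variable alpha : int.
Hypothesis alpha1 : (4 %| alpha - 1)%Z.

(** For odd [D] the quartic symbol of [D] depends only on [x] modulo [D], up to a
    correction through the parity of [x / 2] (recall that [x] is even). *)
Lemma qsym_odd_shift_nat (n : nat) : odd n ->
  exists c : nat, forall x1 x2 : nat,
    two_square_prime alpha x1 -> two_square_prime alpha x2 ->
    ~~ (sqsum alpha x1 %| n)%N -> ~~ (sqsum alpha x2 %| n)%N ->
    x1 = x2 %[mod n] ->
    qsym alpha x1 n%:Z + c * x1 = qsym alpha x2 n%:Z + c * x2 %[mod 4].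
Proof.
elim/ltn_ind: n => n IH n_odd; have [n1|n1] := leqP n 1.
  exists 0%N => x1 x2 P1 P2 _ _ _.
  have -> : n = 1%N by case: n n_odd n1 {IH} => [|[]].
  by rewrite !qsym1.
have q_pr := pdiv_prime n1; have /dvdnP[m nE] := pdiv_dvd n.
move: nE q_pr; set q := pdiv n => nE q_pr.
have [m_odd q_odd] : odd m /\ odd q by move: n_odd; rewrite nE oddM => /andP[].
have [c hc] : exists c : nat, forall x1 x2 : nat,
    two_square_prime alpha x1 -> two_square_prime alpha x2 ->
    ~~ (sqsum alpha x1 %| m)%N -> ~~ (sqsum alpha x2 %| m)%N ->
    x1 = x2 %[mod m] ->
    qsym alpha x1 m%:Z + c * x1 = qsym alpha x2 m%:Z + c * x2 %[mod 4].
  by apply: IH => //; rewrite nE ltn_Pmulr ?prime_gt1 ?odd_gt0.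
have [d hd] := qsym_prime_shift alpha1 q_pr q_odd.
exists (c + d)%N => x1 x2 P1 P2 n1' n2' e12.
have em : x1 = x2 %[mod m] by apply: eqmod_dvd e12; rewrite nE dvdn_mulr.
have eq : x1 = x2 %[mod q] by apply: eqmod_dvd e12; rewrite nE dvdn_mull.
have half y : two_square_prime alpha y -> ~~ (sqsum alpha y %| n)%N ->
    [/\ ~~ (sqsum alpha y %| m)%N, sqsum alpha y != q &
    qsym alpha y n%:Z = qsym alpha y m%:Z + qsym alpha y q%:Z %[mod 4]].
  move=> Py yn; case/andP: (Py) => y_even p_pr.
  have ym : ~~ (sqsum alpha y %| m)%N by apply: contra yn; rewrite nE; apply: dvdn_mulr.
  have yq : ~~ (sqsum alpha y %| q)%N by apply: contra yn; rewrite nE; apply: dvdn_mull.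
  split=> //; first by apply: contraNneq yq => ->.
  by rewrite nE PoszM; apply: qsymM.
have [m1 q1 s1] := half _ P1 n1'; have [m2 q2 s2] := half _ P2 n2'.
have hm := hc _ _ P1 P2 m1 m2 em; have hq := hd _ _ P1 P2 q1 q2 eq.
rewrite !mulnDl; exact: shift_arith hm hq s1 s2.
Qed.

End Shift.

Lemma exactly_divides_odd_part (k : nat) (D : int) : exactly_divides 2 k D ->
  exists2 D' : int, D = 2 ^+ k * D' & odd `|D'|%N.
Proof.
move=> /andP[/dvdzP[D' DE] nd]; exists D'; first by rewrite mulrC.
apply: contraNT nd => ev.
by rewrite exprSr DE [D' * _]mulrC dvdz_mul2l ?expf_neq0 // dvdzE /= dvdn2.
Qed.

Section EvenShift.

Variables (alpha D D' : int) (k : nat).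
Hypotheses (alpha1 : (4 %| alpha - 1)%Z).
Hypotheses (DE : D = 2 ^+ k * D') (D'_odd : odd `|D'|%N) (k_odd : odd k).

Lemma sqsum_ndvd_odd_part x : ~~ ((sqsum alpha x)%:Z %| D)%Z ->
  ~~ (sqsum alpha x %| `|D'|)%N.
Proof. by apply: contra => pD; rewrite DE dvdz_mull. Qed.

(** A negative sign contributes the symbol of -1, which is congruent to [x]. *)
Lemma qsym_abs_congr x : two_square_prime alpha x ->
  ~~ ((sqsum alpha x)%:Z %| D)%Z ->
  qsym alpha x D' =
  qsym alpha x `|D'|%N%:Z + (if (0 <= D')%R then 0%N else x) %[mod 4].
Proof.
move=> xP pD; case/andP: (xP) => x_even p_pr.
have [D0|D0] := leP 0 D'; first by rewrite gez0_abs // addn0.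
have p1 : ~~ ((sqsum alpha x)%:Z %| -1)%Z.
  by rewrite -[(_ %| _)%Z]/(sqsum alpha x %| 1)%N dvdn1 neq_ltn prime_gt1 ?orbT.
have pa : ~~ ((sqsum alpha x)%:Z %| `|D'|%N%:Z)%Z := sqsum_ndvd_odd_part pD.
have h := qsymM alpha1 x_even p_pr p1 pa.
have -> : D' = -1 * `|D'|%N%:Z by rewrite (ltz0_abs D0) mulN1r opprK.
rewrite {2}mulN1r abszN absz_nat; apply: (etrans h).
by rewrite addnC -modnDmr qsymN1 // modnDmr.
Qed.

Lemma qsym_factor x : two_square_prime alpha x ->
  ~~ ((sqsum alpha x)%:Z %| D)%Z ->
  qsym alpha x D = k * x./2 + qsym alpha x D' %[mod 4].
Proof.
move=> xP pD; case/andP: (xP) => x_even p_pr.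
have p2 := sqsum_ndvd_2 alpha1 xP.
have f_prim := sqrtN1_prim alpha1 x_even p_pr.
have p2k : ~~ ((sqsum alpha x)%:Z %| 2 ^+ k)%Z.
  by apply: contra pD => h; rewrite DE dvdz_mulr.
have pD' : ~~ ((sqsum alpha x)%:Z %| D')%Z := sqsum_ndvd_odd_part pD.
rewrite DE; apply: (etrans (qsymM alpha1 x_even p_pr p2k pD')).
rewrite -modnDml; rewrite -[in RHS]modnDml; congr ((_ + _) %% _)%N.
have t0 : 2%:~R != 0 :> 'F_(sqsum alpha x) by rewrite Fp_int_eq0.
have := qlogX f_prim k t0; rewrite -rmorphXn -/(qsym alpha x _) => /= h.
apply: (etrans h); rewrite -modnMmr -[in RHS]modnMmr; congr ((_ * _) %% _)%N.
exact: qsym2.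
Qed.

Lemma even_shift_arith u1 u2 s1 s2 t1 t2 e1 e2 k1 k2 c1 c2 :
  u1 = k1 + s1 %[mod 4] -> u2 = k2 + s2 %[mod 4] ->
  s1 = t1 + e1 %[mod 4] -> s2 = t2 + e2 %[mod 4] ->
  t1 + c1 = t2 + c2 %[mod 4] ->
  u1 + (c1 + 3 * e1 + 3 * k1) = u2 + (c2 + 3 * e2 + 3 * k2) %[mod 4].
Proof. lia. Qed.

(** Since the power of 2 in [D] is odd, adding [D'] to [x / 2] multiplies the
    symbol of [D] by a primitive fourth root of unity. *)
Lemma qsym_shift : exists2 u : nat, odd u & forall x1 x2 : nat,
    two_square_prime alpha x1 -> two_square_prime alpha x2 ->
    ~~ ((sqsum alpha x1)%:Z %| D)%Z -> ~~ ((sqsum alpha x2)%:Z %| D)%Z ->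
    x1 = x2 %[mod `|D'|%N] ->
    qsym alpha x1 D + u * x1./2 = qsym alpha x2 D + u * x2./2 %[mod 4].
Proof.
have [c hc] := qsym_odd_shift_nat alpha1 D'_odd.
pose neg : nat := if 0 <= D' then 0%N else 1%N.
exists (2 * c + 6 * neg + 3 * k)%N.
  by move: neg k_odd => b; clear; lia.
move=> x1 x2 P1 P2 n1 n2 e12.
have h := hc _ _ P1 P2 (sqsum_ndvd_odd_part n1) (sqsum_ndvd_odd_part n2) e12.
have E (x : nat) : (if 0 <= D' then 0%N else x) = (neg * x)%N.
  by rewrite /neg; case: ifP => _; rewrite ?mul1n.
have s1 := qsym_abs_congr P1 n1; have s2 := qsym_abs_congr P2 n2.
rewrite E in s1; rewrite E in s2.
have uE x : two_square_prime alpha x ->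
   ((2 * c + 6 * neg + 3 * k) * x./2 = c * x + 3 * (neg * x) + 3 * (k * x./2))%N.
  move=> /andP[x_even _]; rewrite -{2 3}(even_halfK x_even) -mul2n.
  by move: (x./2) (neg) => y b; clear; lia.
rewrite !uE //.
exact: even_shift_arith (qsym_factor P1 n1) (qsym_factor P2 n2) s1 s2 h.
Qed.

End EvenShift.

Section TraceValues.

Variables (alpha D : int) (x : nat).
Hypotheses (alpha1 : (4 %| alpha - 1)%Z) (xP : two_square_prime alpha x).
Hypothesis pD : ~~ ((sqsum alpha x)%:Z %| D)%Z.

Lemma trace_frob_eq_alpha :
  (trace_frob D (sqsum alpha x) == 2 * alpha) = (qsym alpha x D == 0%N).
Proof.
case/andP: xP => x_even p_pr; rewrite trace_frob_qsym //.
case/dvdzP: alpha1 => a ea; have xe := even_halfK x_even.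
have := qsym_lt4 alpha x D; case: (qsym _ _ _) => [|[|[|[|//]]]] _ /=; lia.
Qed.

Lemma trace_frob_eqN_alpha :
  (trace_frob D (sqsum alpha x) == 2 * - alpha) = (qsym alpha x D == 2%N).
Proof.
case/andP: xP => x_even p_pr; rewrite trace_frob_qsym //.
case/dvdzP: alpha1 => a ea; have xe := even_halfK x_even.
have := qsym_lt4 alpha x D; case: (qsym _ _ _) => [|[|[|[|//]]]] _ /=; lia.
Qed.

End TraceValues.

(** * Chebyshev's upper bound *)

Lemma bin_le_exp2 n k : ('C(n.+1, k) <= 2 ^ n)%N.
Proof.
elim: n k => [|n IH] [|k]; rewrite ?bin0 ?expn_gt0 //; first by case: k.
by rewrite binS expnS mul2n -addnn leq_add.
Qed.

Lemma prod_primes_dvdn (s : seq nat) (N : nat) :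
  uniq s -> all prime s -> all (dvdn^~ N) s -> (\prod_(p <- s) p %| N)%N.
Proof.
elim: s => [|p s IH] /=; first by rewrite big_nil dvd1n.
move=> /andP[ps us] /andP[p_pr s_pr] /andP[pN sN].
rewrite big_cons Gauss_dvd ?pN ?IH // prime_coprime //.
rewrite Euclid_dvd_prod // big_has; apply/negP => /hasP[q qs /=].
have q_pr := allP s_pr _ qs; rewrite dvdn_prime2 // => /eqP pq.
by move: ps; rewrite pq qs.
Qed.

Lemma prime_dvd_fact_leq p n : prime p -> (p %| n`!)%N -> (p <= n)%N.
Proof.
move=> p_pr; elim: n => [|n IH]; first by rewrite dvdn1 (gtn_eqF (prime_gt1 p_pr)).
rewrite factS Euclid_dvdM // => /orP[/dvdn_leq -> //|/IH]; exact: leqW.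
Qed.

Definition primorial (n : nat) : nat := (\prod_(0 <= p < n.+1 | prime p) p)%N.

(** These primes all divide the binomial coefficient of [2 * m + 1] and [m], which
    is at most [4 ^ m]. *)
Lemma prod_primes_middle m :
  (\prod_(m.+2 <= p < (2 * m).+2 | prime p) p <= 4 ^ m)%N.
Proof.
have le : ('C((2 * m).+1, m) <= 4 ^ m)%N.
  have := bin_le_exp2 (2 * m).+1%N m.+1.
  have eC : ('C((2 * m).+1, m.+1) = 'C((2 * m).+1, m))%N.
    rewrite -[LHS]bin_sub; first by rewrite subSS mul2n -addnn addnK.
    by rewrite ltnS mul2n -addnn leq_addr.
  by rewrite binS eC addnn -mul2n expnS expnM leq_pmul2l.
apply: leq_trans le; apply: dvdn_leq; first by rewrite bin_gt0; lia.
rewrite -big_filter; apply: prod_primes_dvdn.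
- by rewrite filter_uniq ?iota_uniq.
- by apply/allP => p; rewrite mem_filter => /andP[].
apply/allP => p; rewrite mem_filter mem_index_iota => /and3P[p_pr pm pM].
have := bin_fact (_ : m <= (2 * m).+1)%N => /(_ ltac:(lia)) e.
have : (p %| (2 * m).+1`!)%N by rewrite dvdn_fact // prime_gt0.
by rewrite -e !Euclid_dvdM // => /orP[//|/orP[]] /(prime_dvd_fact_leq p_pr); lia.
Qed.

(** Induction from [n] to about [n / 2]; an even number greater than 2 is not
    prime and can be skipped. *)
Lemma primorial_le n : (primorial n <= 4 ^ n)%N.
Proof.
elim/ltn_ind: n => n IH; have [n_odd|n_even] := boolP (odd n).
  have nE : n = (2 * n./2).+1 by rewrite -{1}(odd_double_half n) n_odd mul2n.
  set m := n./2 in nE; case: m nE => [|m] nE.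
    by rewrite nE /primorial unlock.
  rewrite /primorial nE (@big_cat_nat _ _ _ m.+3) //=; last by lia.
  have -> : (4 ^ (2 * m.+1).+1 = 4 ^ m.+2 * 4 ^ m.+1)%N by rewrite -expnD; congr expn; lia.
  by apply: leq_mul; [apply: IH; lia|apply: prod_primes_middle].
case: n IH n_even => [|[|[|n]]] IH n_even //.
- by rewrite /primorial unlock.
- by rewrite /primorial unlock.
rewrite /primorial big_mkcond big_nat_recr //= -big_mkcond.
have -> : prime n.+3 = false.
  by apply/negP => /even_prime[//|o]; rewrite o in n_even.
rewrite muln1; apply: leq_trans (IH n.+2 _) _ => //.
by rewrite leq_exp2l.
Qed.

(** * Mertens's theorem for the character modulo 4 *)

(** The nontrivial character modulo 4, that is the Legendre symbol of -1. *)
Definition chi4 (n : nat) : int :=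
  if odd n then (if (n %% 4 == 1)%N then 1 else -1) else 0.

Lemma chi4M a b : chi4 (a * b)%N = chi4 a * chi4 b.
Proof.
rewrite /chi4 oddM; case: (boolP (odd a)) => //= oa; last by rewrite mul0r.
case: (boolP (odd b)) => //= ob; last by rewrite mulr0.
rewrite -modnMm; have : (a %% 4 = 1 \/ a %% 4 = 3)%N by lia.
have : (b %% 4 = 1 \/ b %% 4 = 3)%N by lia.
by case=> -> [] ->.
Qed.

Lemma chi4_range n : [\/ chi4 n = 0, chi4 n = 1 | chi4 n = -1].
Proof.
rewrite /chi4; case: ifP => _; last by constructor 1.
by case: ifP => _; [constructor 2|constructor 3].
Qed.

Section Mertens.

Variable R : realType.

Local Notation chi j := ((chi4 j)%:~R : R).

Lemma chi4_norm n : `|chi n| <= 1.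
Proof. by case: (chi4_range n) => ->; rewrite ?normr0 ?rmorphN1 ?normrN ?normr1. Qed.

Lemma sum_chi4_prefix n :
  \sum_(0 <= j < n) chi j = ((n %% 4 == 2) || (n %% 4 == 3))%N%:R.
Proof.
elim: n => [|n IH]; first by rewrite big_geq.
rewrite big_nat_recr //= IH /chi4.
have [q [r [-> rlt]]] : exists q r, (n = q * 4 + r /\ r < 4)%N.
  by exists (n %/ 4)%N, (n %% 4)%N; rewrite -divn_eq ltn_pmod.
rewrite oddD oddM andbF /= -addnS !modnMDl.
by case: r rlt => [|[|[|[|//]]]] _ //=; rewrite ?modn_small //= ?add0r ?addr0 ?rmorphN1 ?subrr.
Qed.

Lemma sum_chi4_norm m n : (m <= n)%N -> `|\sum_(m <= j < n) chi j| <= 1.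
Proof.
move=> mn; have := sum_chi4_prefix n; rewrite (@big_cat_nat _ _ _ m) //= sum_chi4_prefix.
move=> /(canRL (addKr _)) ->; rewrite addrC.
by do 2?case: (_ || _); rewrite ?subr0 ?sub0r ?subrr ?normrN ?normr0 ?normr1.
Qed.

(** Abel summation against a nonincreasing sequence. *)
Lemma abel_bound (c b : nat -> R) (B : R) (m n : nat) : (m <= n)%N ->
  (forall k, (m <= k)%N -> b k.+1 <= b k) -> (forall k, (m <= k)%N -> 0 <= b k) ->
  (forall k, (m <= k)%N -> `|\sum_(m <= j < k) c j| <= B) ->
  `|\sum_(m <= j < n) c j * b j| <= B * b m.
Proof.
move=> mn b_noninc b_ge0 cB.
(* bound the sum minus its boundary term, which makes the induction telescope *)
have main : `|\sum_(m <= j < n) c j * b j - (\sum_(m <= j < n) c j) * b n|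
    <= B * (b m - b n).
  rewrite -(subnKC mn); elim: (n - m)%N => [|d IH].
    by rewrite addn0 !big_geq // mul0r !subrr normr0 mulr0.
  have md : (m <= m + d)%N by exact: leq_addr.
  rewrite addnS !big_nat_recr //=.
  set S := \sum_(m <= j < m + d) _ * _ in IH *; set C := \sum_(m <= j < m + d) _ in IH *.
  set k := (m + d)%N in IH md *.
  have -> : S + c k * b k - (C + c k) * b k.+1 =
      (S - C * b k) + (C + c k) * (b k - b k.+1) by ring.
  have -> : B * (b m - b k.+1) = B * (b m - b k) + B * (b k - b k.+1) by ring.
  apply: (le_trans (ler_normD _ _)); apply: lerD => //.
  rewrite normrM [X in _ * X]ger0_norm ?subr_ge0 ?b_noninc //.
  apply: ler_wpM2r; first by rewrite subr_ge0 b_noninc.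
  by have := cB k.+1 (leqW md); rewrite big_nat_recr.
set S := \sum_(m <= j < n) _ * _ in main *; set C := \sum_(m <= j < n) _ in main.
have -> : S = (S - C * b n) + C * b n by rewrite subrK.
have -> : B * b m = B * (b m - b n) + B * b n by ring.
apply: (le_trans (ler_normD _ _)); apply: lerD => //.
by rewrite normrM [X in _ * X]ger0_norm ?b_ge0 // ler_wpM2r ?b_ge0 ?cB.
Qed.

(** Partial sums of the series for the value at 1 of the L-function of [chi4]. *)
Definition Lsum (n : nat) : R := \sum_(1 <= j < n.+1) chi j / j%:R.

Lemma invn_noninc k : (1 <= k)%N -> (k.+1%:R : R)^-1 <= k%:R^-1.
Proof. by move=> k1; rewrite lef_pV2 ?posrE ?ltr0n // ler_nat. Qed.

Lemma sum_chi4_inv m n : (1 <= m)%N -> (m <= n)%N ->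
  `|\sum_(m <= j < n) chi j / j%:R| <= m%:R^-1.
Proof.
move=> m1 mn; rewrite -[leRHS]mul1r; apply: (@abel_bound _ (fun j => j%:R^-1)) => //.
- by move=> k mk; apply: invn_noninc; apply: leq_trans mk.
- exact: sum_chi4_norm.
Qed.

Lemma Lsum_diff m n : (m <= n)%N -> `|Lsum m - Lsum n| <= m.+1%:R^-1.
Proof.
move=> mn; rewrite /Lsum distrC [X in `|X - _|](@big_cat_nat _ _ _ m.+1) //=.
by rewrite addrAC subrr add0r sum_chi4_inv.
Qed.

Lemma Lsum_norm n : `|Lsum n| <= 1.
Proof. by have := @sum_chi4_inv 1 n.+1 isT isT; rewrite invr1. Qed.

(** The terms after the first contribute at most [1 / 3] in absolute value. That
    the sums stay away from 0 is the nonvanishing of the L-function at 1. *)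
Lemma Lsum_ge n : (1 <= n)%N -> 2 / 3 <= Lsum n.
Proof.
move=> n1; have L1 : Lsum 1 = 1 by rewrite /Lsum big_nat1 /chi4 /= divr1.
have [n2|n2] := leqP n 1.
  have -> : n = 1%N by apply/eqP; rewrite eqn_leq n2.
  by rewrite L1; lra.
have L2 : Lsum 2 = 1 by rewrite /Lsum big_nat_recr //= big_nat1 /chi4 /= divr1 mul0r addr0.
have := Lsum_diff n2; rewrite L2 ler_norml => /andP[_].
by lra.
Qed.

Lemma ln4_ge1 : 1 <= ln (4 : R).
Proof.
have -> : (4 : R) = 2 * 2 by rewrite -natrM.
rewrite lnM ?posrE //; have : ln (2^-1 : R) <= - 2^-1.
  by have := @le_ln1Dx R (- 2^-1); rewrite (_ : 1 + - 2^-1 = 2^-1); lra.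
by rewrite lnV ?posrE //; lra.
Qed.

Lemma ln_div_noninc k : (4 <= k)%N ->
  ln (k.+1%:R : R) / k.+1%:R <= ln k%:R / k%:R.
Proof.
move=> k4; have k0 : 0 < k%:R :> R by rewrite ltr0n; apply: leq_trans k4.
have kS : k.+1%:R = k%:R * (1 + k%:R^-1) :> R.
  by rewrite mulrDr mulr1 divff ?gt_eqF // -natr1.
have lnk : 1 <= ln k%:R :> R.
  by apply: (le_trans ln4_ge1); rewrite ler_ln ?posrE // ler_nat.
have lnS : ln k.+1%:R <= ln k%:R + k%:R^-1 :> R.
  have i0 : 0 < k%:R^-1 :> R by rewrite invr_gt0.
  rewrite kS lnM ?posrE ?addr_gt0 //; apply: lerD => //.
  by apply: le_ln1Dx; apply: lt_trans i0; rewrite ltrN10.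
rewrite ler_pdivrMr ?ltr0n // mulrAC ler_pdivlMr //.
apply: (le_trans (ler_wpM2r (ltW k0) lnS)).
rewrite mulrDl mulVf ?gt_eqF // -natr1 mulrDr mulr1; lra.
Qed.

(** The function [ln j / j] is nonincreasing from 4 on, so the sum is bounded by
    its first terms and the value at 4. *)
Lemma sum_chi4_ln n : `|\sum_(1 <= j < n.+1) chi j * (ln j%:R / j%:R)| <= 2.
Proof.
have l3 : `|ln (3%:R : R) / 3%:R| <= 1.
  rewrite ger0_norm ?divr_ge0 ?ln_ge0 ?ler1n //.
  by rewrite ler_pdivrMr // mul1r ltW // ln_sublinear.
have head m : (m <= 4)%N -> `|\sum_(1 <= j < m) chi j * (ln j%:R / j%:R : R)| <= 1.
  case: m => [|[|[|[|[|//]]]]] _; try by rewrite big_geq // normr0.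
  - by rewrite big_nat1 ln1 mul0r mulr0 normr0.
  - by rewrite big_nat_recr //= big_nat1 ln1 mul0r mulr0 add0r mul0r normr0.
  - rewrite big_nat_recr //= big_nat_recr //= big_nat1 ln1 mul0r mulr0 add0r mul0r add0r.
    by rewrite normrM (le_trans (ler_wpM2r _ (chi4_norm 3))) ?normr_ge0 ?mul1r.
have [n4|n4] := leqP n.+1 4; first by apply: (le_trans (head _ n4)); rewrite ler1n.
rewrite (@big_cat_nat _ _ _ 4) //=; last by exact: ltnW.
apply: (le_trans (ler_normD _ _)); rewrite (_ : 2 = 1 + 1 :> R) //; last first.
apply: lerD; first exact: head.
apply: (@le_trans _ _ (1 * (ln 4%:R / 4%:R))).
  apply: (@abel_bound _ (fun j => ln j%:R / j%:R)) => //; first exact: ltnW.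
  - exact: ln_div_noninc.
  - by move=> k k4; rewrite divr_ge0 // ln_ge0 // ler1n; apply: leq_trans k4.
  - exact: sum_chi4_norm.
by rewrite mul1r ler_pdivrMr // mul1r ltW // ln_sublinear.
Qed.

Lemma theta_le n :
  \sum_(0 <= p < n.+1 | prime p) ln (p%:R : R) <= n%:R * ln 4.
Proof.
have -> : \sum_(0 <= p < n.+1 | prime p) ln (p%:R : R) = ln (primorial n)%:R.
  rewrite /primorial; elim: (n.+1) => [|m IH]; first by rewrite !big_geq // ln1.
  rewrite big_mkcond [in RHS]big_mkcond !big_nat_recr //= -!big_mkcond IH.
  case: ifP => [m_pr|_]; last by rewrite addr0 muln1.
  rewrite natrM lnM ?posrE ?ltr0n ?(prime_gt0 m_pr) //.
  by rewrite prodn_cond_gt0 //; exact: prime_gt0.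
rewrite mulrC mulr_natr -lnXn // ler_ln ?posrE ?exprn_gt0 ?ltr0n //.
  by rewrite -natrX ler_nat primorial_le.
by rewrite prodn_cond_gt0 //; exact: prime_gt0.
Qed.

End Mertens.

Section MertensSum.

Variable R : realType.

Local Notation chi j := ((chi4 j)%:~R : R).

Lemma sum_multiples (F : nat -> R) (d n : nat) : (0 < d)%N ->
  \sum_(1 <= m < n.+1 | (d %| m)%N) F m = \sum_(1 <= j < (n %/ d).+1) F (d * j)%N.
Proof.
move=> d0; elim: n => [|n IH]; first by rewrite div0n !big_geq.
rewrite big_mkcond big_nat_recr //= -big_mkcond IH divnS //.
case: (boolP (d %| n.+1)%N) => [dn|_]; last by rewrite add0n addr0.
rewrite add1n [RHS]big_nat_recr //=; congr (_ + F _).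
have := divnS n d0; rewrite dn add1n => <-.
by rewrite mulnC divnK.
Qed.

Lemma sum_leq_indicator (e n : nat) : (e <= n)%N ->
  \sum_(1 <= k < n.+1) (if (k <= e)%N then 1 else 0) = e%:R :> R.
Proof.
move=> en; rewrite (@big_cat_nat _ _ _ e.+1) //=.
rewrite [X in _ + X](eq_big_nat _ _ (F2 := fun=> 0)); last first.
  by move=> k /andP[ek _]; rewrite leqNgt ek.
rewrite [X in _ + X]big1 // addr0.
rewrite (eq_big_nat _ _ (F2 := fun=> 1)); last by move=> k /andP[_ ke]; rewrite -ltnS ke.
by rewrite sumr_const_nat subn1.
Qed.

Lemma ln_prod_nat (F : nat -> nat) n : (forall p, (0 < F p)%N) ->
  ln (\prod_(0 <= p < n) F p)%N%:R = \sum_(0 <= p < n) ln (F p)%:R :> R.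
Proof.
move=> F0; elim: n => [|n IH]; first by rewrite !big_geq // ln1.
by rewrite !big_nat_recr //= natrM lnM ?posrE ?ltr0n ?prodn_gt0 // IH.
Qed.

Lemma ln_prime_powers m n : (1 <= m <= n)%N ->
  ln (m%:R : R) = \sum_(0 <= p < n.+1 | prime p) \sum_(1 <= k < n.+1)
    (if (p ^ k %| m)%N then ln p%:R else 0).
Proof.
move=> /andP[m1 mn]; rewrite -{1}(partnT m1) (widen_partn _ mn) ln_prod_nat; last first.
  move=> p; rewrite expn_gt0; case: (posnP (logn p m)) => [_|e0]; first by rewrite orbT.
  by move: e0; rewrite logn_gt0 mem_primes => /andP[/prime_gt0->].
rewrite [RHS]big_mkcond; apply: eq_bigr => p _.
case: ifP => [p_pr|]; last by move=> np; rewrite /logn np expn0 ln1.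
rewrite natrX lnXn ?ltr0n ?prime_gt0 // -[ln _ *+ _]mulr_natl.
rewrite -(@sum_leq_indicator (logn p m) n) ?mulr_suml; last first.
  by apply: leq_trans mn; apply: ltnW; apply: ltn_logl.
apply: eq_bigr => k _; rewrite pfactor_dvdn //.
by case: ifP => _; rewrite ?mul1r ?mul0r.
Qed.

Lemma sum_chi4_multiples d n : (0 < d)%N ->
  \sum_(1 <= m < n.+1 | (d %| m)%N) chi m / m%:R =
  chi d / d%:R * Lsum R (n %/ d).
Proof.
move=> d0; rewrite sum_multiples // /Lsum mulr_sumr; apply: eq_bigr => j _.
by rewrite chi4M rmorphM natrM invfM /=; ring.
Qed.

(** Exchange the sum over [m] with the sum over the prime powers dividing [m]; the
    character is completely multiplicative. *)
Lemma sum_chi4_ln_primes n :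
  \sum_(1 <= m < n.+1) chi m * (ln m%:R / m%:R) =
  \sum_(0 <= p < n.+1 | prime p) ln p%:R * \sum_(1 <= k < n.+1)
    chi (p ^ k)%N / (p ^ k)%N%:R * Lsum R (n %/ p ^ k).
Proof.
transitivity (\sum_(1 <= m < n.+1) \sum_(0 <= p < n.+1 | prime p)
   \sum_(1 <= k < n.+1) (if (p ^ k %| m)%N then ln p%:R * (chi m / m%:R) else 0)).
  apply: eq_big_nat => m m1n; rewrite (ln_prime_powers m1n) mulrA mulrAC.
  rewrite -/(_ / _) mulr_sumr; apply: eq_bigr => p _.
  rewrite mulr_sumr; apply: eq_bigr => k _.
  by case: ifP => _; rewrite ?mulr0 // mulrC.
rewrite exchange_big /=; apply: eq_bigr => p p_pr.
rewrite exchange_big /= mulr_sumr; apply: eq_bigr => k _.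
by rewrite -sum_chi4_multiples ?expn_gt0 ?prime_gt0 // mulr_sumr -big_mkcond.
Qed.

Lemma geometric_tail (x : R) n : 0 <= x <= 2^-1 ->
  \sum_(2 <= k < n) x ^+ k <= 2 * x ^+ 2.
Proof.
move=> /andP[x0 x1].
have [n2|n2] := leqP n 2; first by rewrite big_geq // mulr_ge0 ?exprn_ge0.
have e : (\sum_(2 <= k < n) x ^+ k) * (1 - x) = x ^+ 2 - x ^+ n.
  rewrite -(subnKC (ltnW n2)); elim: (n - 2)%N => [|d IH].
    by rewrite addn0 big_geq // mul0r subrr.
  by rewrite addnS big_nat_recr ?leq_addr //= mulrDl IH [x ^+ (2 + d).+1]exprS; ring.
have S0 : 0 <= \sum_(2 <= k < n) x ^+ k by apply: sumr_ge0 => k _; rewrite exprn_ge0.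
have : (\sum_(2 <= k < n) x ^+ k) * 2^-1 <= x ^+ 2.
  apply: (@le_trans _ _ ((\sum_(2 <= k < n) x ^+ k) * (1 - x))).
    by apply: ler_wpM2l => //; lra.
  by rewrite e lerBlDr lerDl exprn_ge0.
by rewrite ler_pdivrMr // mulrC.
Qed.

(** The function [(ln m + 2) / m] decreases by at least [ln m / m ^ 2]. *)
Lemma sum_ln_sqr n : \sum_(2 <= m < n.+1) ln (m%:R : R) / m%:R ^+ 2 <= 2.
Proof.
pose g m : R := (ln m%:R + 2) / m%:R.
have step m : (1 <= m)%N -> ln (m.+1%:R : R) / m.+1%:R ^+ 2 <= g m - g m.+1.
  move=> m1; have m0 : 0 < m%:R :> R by rewrite ltr0n.
  have mS : m.+1%:R = m%:R + 1 :> R by rewrite -natr1.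
  have l0 : 0 <= ln (m.+1%:R : R) by rewrite ln_ge0 // ler1n.
  have lb : ln (m.+1%:R : R) - m%:R^-1 <= ln m%:R.
    rewrite lerBlDr.
    have -> : m.+1%:R = m%:R * (1 + m%:R^-1) :> R.
      by rewrite mulrDr mulr1 divff ?gt_eqF // -natr1.
    have i0 : 0 < m%:R^-1 :> R by rewrite invr_gt0.
    rewrite lnM ?posrE ?addr_gt0 // lerD2l.
    by apply: le_ln1Dx; apply: lt_trans i0; rewrite ltrN10.
  rewrite /g mS; rewrite mS in l0 lb.
  set l := ln _ in l0 lb *; set l' := ln m%:R in lb *; set t := m%:R in m0 lb *.
  have t1 : 1 <= t by rewrite /t ler1n.
  apply: (@le_trans _ _ ((l - t^-1 + 2) / t - (l + 2) / (t + 1))); last first.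
    by rewrite lerD2r ler_pM2r ?invr_gt0 // lerD2r.
  rewrite -subr_ge0.
  have -> : (l - t^-1 + 2) / t - (l + 2) / (t + 1) - l / (t + 1) ^+ 2 =
    (l * t + (t ^+ 2 - 1)) / (t ^+ 2 * (t + 1) ^+ 2).
    by field; rewrite !gt_eqF //; lra.
  apply: divr_ge0; last by rewrite mulr_ge0 ?sqr_ge0.
  apply: addr_ge0; first by apply: mulr_ge0 => //; apply: ltW.
  by rewrite subr_ge0 exprn_ege1.
have [n0|n0] := leqP n 0; first by rewrite big_geq // ltnS (leq_trans n0).
have -> : (2 : R) = g 1%N by rewrite /g ln1 add0r divr1.
have main : \sum_(2 <= m < n.+1) ln (m%:R : R) / m%:R ^+ 2 <= g 1%N - g n.
  case: n n0 => // n _; elim: n => [|n IH]; first by rewrite big_geq // subrr.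
  rewrite big_nat_recr //= (_ : g 1%N - g n.+2 = (g 1%N - g n.+1) + (g n.+1 - g n.+2)).
    by apply: lerD => //; apply: step.
  by rewrite addrA subrK.
apply: (le_trans main); rewrite lerBlDr lerDl divr_ge0 // addr_ge0 // ln_ge0 //.
by rewrite ler1n.
Qed.

Definition Mertens_sum (n : nat) : R :=
  \sum_(0 <= p < n.+1 | prime p) chi p * (ln p%:R / p%:R).

(** In the partial sums of [chi m * ln m / m], decompose [ln m] over the prime
    powers dividing [m]: the primes contribute [Mertens_sum n] times a partial sum
    of [chi j / j], which is bounded below; the errors are controlled by
    Chebyshev's bound and by a convergent series. *)
Lemma Mertens_sum_bounded n : `|Mertens_sum n| <= 14.
Proof.
have [n0|n0] := leqP n 0.
  move: n0; rewrite leqn0 => /eqP ->; rewrite /Mertens_sum big_mkcond big_nat1 /=.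
  by rewrite normr0.
have main := sum_chi4_ln_primes n; have Abound := @sum_chi4_ln R n.
(* [E1] is the error of replacing each [Lsum R (n %/ p)] by [Lsum R n], and [E2]
   collects the proper prime powers *)
pose E1 : R := \sum_(0 <= p < n.+1 | prime p)
  chi p * (ln p%:R / p%:R) * (Lsum R (n %/ p) - Lsum R n).
pose E2 : R := \sum_(0 <= p < n.+1 | prime p) ln p%:R *
  \sum_(2 <= k < n.+1) chi (p ^ k)%N / (p ^ k)%N%:R * Lsum R (n %/ p ^ k).
have eA : \sum_(1 <= m < n.+1) chi m * (ln m%:R / m%:R) =
    Lsum R n * Mertens_sum n + E1 + E2.
  rewrite main /E1 /E2 /Mertens_sum mulr_sumr -!big_split /=; apply: eq_bigr => p p_pr.
  rewrite big_ltn // expn1 mulrDr; congr (_ + _); ring.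
have lnp_ge0 p : prime p -> 0 <= ln (p%:R : R).
  by move=> p_pr; rewrite ln_ge0 // ler1n prime_gt0.
(* Chebyshev's bound divided by [n] *)
have E1_le : `|E1| <= ln 4.
  apply: (le_trans (ler_norm_sum _ _ _)).
  apply: (@le_trans _ _ (\sum_(0 <= p < n.+1 | prime p) n%:R^-1 * ln (p%:R : R))); last first.
    rewrite -mulr_sumr ler_pdivrMl ?ltr0n //; exact: theta_le.
  apply: ler_sum => p p_pr; have p0 := prime_gt0 p_pr.
  have pR : 0 < p%:R :> R by rewrite ltr0n.
  rewrite normrM normrM [X in _ * X * _]ger0_norm ?divr_ge0 ?lnp_ge0 //.
  have d1 : `|Lsum R (n %/ p) - Lsum R n| <= p%:R / n%:R.
    apply: (le_trans (Lsum_diff _ (leq_div _ _))).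
    rewrite -[leLHS]div1r ler_pdivrMr ?ltr0n // mulrAC ler_pdivlMr ?ltr0n //.
    by rewrite mul1r -natrM ler_nat mulnC ltnW // ltn_ceil.
  apply: (@le_trans _ _ (1 * (ln p%:R / p%:R) * (p%:R / n%:R))).
    apply: ler_pM => //.
    - by rewrite mulr_ge0 ?divr_ge0 ?lnp_ge0.
    - by apply: ler_wpM2r; rewrite ?divr_ge0 ?lnp_ge0 ?chi4_norm.
  by rewrite mul1r mulrA mulfVK ?gt_eqF // mulrC.
have E2_le : `|E2| <= 4.
  apply: (le_trans (ler_norm_sum _ _ _)).
  apply: (@le_trans _ _ (\sum_(0 <= p < n.+1 | prime p) 2 * (ln (p%:R : R) / p%:R ^+ 2))).
    apply: ler_sum => p p_pr; have p0 := prime_gt0 p_pr; have p1 := prime_gt1 p_pr.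
    have pR : 0 < p%:R :> R by rewrite ltr0n.
    rewrite normrM ger0_norm ?lnp_ge0 // mulrCA; apply: ler_wpM2l; first exact: lnp_ge0.
    rewrite -exprVn; apply: (le_trans (ler_norm_sum _ _ _)).
    apply: (@le_trans _ _ (\sum_(2 <= k < n.+1) p%:R^-1 ^+ k)).
      apply: ler_sum => k _; rewrite normrM normrM.
      rewrite [X in _ * X * _]ger0_norm ?invr_ge0 // natrX -exprVn.
      rewrite -[leRHS]mulr1; apply: ler_pM; rewrite ?mulr_ge0 ?Lsum_norm ?exprn_ge0 ?invr_ge0 //.
      by rewrite -[leRHS]mul1r; apply: ler_wpM2r; rewrite ?chi4_norm ?exprn_ge0 ?invr_ge0.
    apply: geometric_tail; rewrite invr_ge0 ler0n /=.
    by rewrite lef_pV2 ?posrE ?ltr0n // ler_nat.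
  rewrite -mulr_sumr (_ : 4 = 2 * 2 :> R); last by rewrite -natrM.
  apply: ler_wpM2l => //; apply: le_trans (sum_ln_sqr n).
  rewrite big_mkcond [leRHS]big_mkcond (@big_cat_nat _ _ _ 2) //=.
  rewrite big_nat_recr //= big_nat1 /= !add0r.
  apply: ler_sum => p _; case: ifP => // _.
  case: p => [|p]; first by rewrite ln0 // mul0r.
  by rewrite divr_ge0 ?exprn_ge0 // ln_ge0 // ler1n.
have ln4_le : ln (4 : R) <= 3.
  by have := @le_ln1Dx R 3; rewrite (_ : 1 + 3 = 4 :> R) ?natrD //; apply; lra.
(* the three bounds add up to at most 2 + 4 + 3, and [Lsum R n] is at least 2 / 3 *)
have LM : `|Lsum R n * Mertens_sum n| <= 9.
  have -> : Lsum R n * Mertens_sum n =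
      \sum_(1 <= m < n.+1) chi m * (ln m%:R / m%:R) - E1 - E2 by rewrite eA; ring.
  apply: (le_trans (ler_normB _ _)).
  have := ler_normB (\sum_(1 <= m < n.+1) chi m * (ln m%:R / m%:R)) E1.
  by lra.
have L23 := Lsum_ge R n0; have L0 : 0 <= Lsum R n by lra.
have : 2 / 3 * `|Mertens_sum n| <= 9.
  apply: le_trans LM; rewrite normrM [X in _ <= X * _]ger0_norm //.
  exact: ler_wpM2r.
by have := normr_ge0 (Mertens_sum n); lra.
Qed.

End MertensSum.

(** * Convergence of the Euler product *)

Section EulerProduct.

Variable R : realType.

Local Open Scope classical_set_scope.

Local Notation chi j := ((chi4 j)%:~R : R).

(** Dirichlet's test: the bounded sums [Mertens_sum] against [1 / ln j]. *)
Lemma sum_chi4_primes m n : (2 <= m)%N -> (m <= n)%N ->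
  `|\sum_(m <= p < n | prime p) chi p / p%:R| <= 28 / ln m%:R.
Proof.
move=> m2 mn; rewrite big_mkcond.
pose c j : R := if prime j then chi j * (ln j%:R / j%:R) else 0.
have ln_gt0' k : (m <= k)%N -> 0 < ln (k%:R : R).
  by move=> mk; rewrite ln_gt0 // ltr1n; apply: leq_trans mk.
rewrite (eq_big_nat _ _ (F2 := fun j => c j * (ln j%:R)^-1)); last first.
  move=> j /andP[mj _]; rewrite /c; case: ifP => _; last by rewrite mul0r.
  by rewrite -mulrA [ln _ / _]mulrC mulfK // gt_eqF ?ln_gt0'.
apply: (@abel_bound _ _ (fun j => (ln j%:R)^-1)) => //.
- move=> k mk; rewrite lef_pV2 ?posrE ?ln_gt0' ?ler_ln ?posrE ?ltr0n ?ler_nat //.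
  + by apply: leq_trans mk; apply: leq_trans m2.
  + exact: leqW.
- by move=> k mk; rewrite invr_ge0 ltW // ln_gt0'.
move=> k mk.
have e j : (0 < j)%N -> \sum_(0 <= i < j) c i = Mertens_sum R j.-1.
  by move=> j0; rewrite /Mertens_sum prednK // [RHS]big_mkcond.
have m0 : (0 < m)%N by apply: leq_trans m2.
have -> : \sum_(m <= j < k) c j = Mertens_sum R k.-1 - Mertens_sum R m.-1.
  rewrite -!e ?(leq_trans m0) // [in RHS](@big_cat_nat _ _ _ m 0 k) //=.
  by rewrite addrAC subrr add0r.
apply: (le_trans (ler_normB _ _)).
have := Mertens_sum_bounded R k.-1; have := Mertens_sum_bounded R m.-1; lra.
Qed.

(** Both bounds come from [ln (1 + t) <= t], applied to [u] and to
    [- u / (1 + u)]. *)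
Lemma ln1D_bounds (u : R) : - 2^-1 <= u -> `|ln (1 + u) - u| <= 2 * u ^+ 2.
Proof.
move=> u1; have p0 : 0 < 1 + u by lra.
have up : ln (1 + u) <= u by apply: le_ln1Dx; lra.
have lo : u / (1 + u) <= ln (1 + u).
  have -> : u / (1 + u) = - (- u / (1 + u)) by rewrite mulNr opprK.
  rewrite lerNl -lnV ?posrE // [X in ln X](_ : _ = 1 + (- u / (1 + u))); last first.
    by field; rewrite gt_eqF.
  apply: le_ln1Dx; rewrite mulNr ltrN2 ltr_pdivrMr //; lra.
have lo2 : u - 2 * u ^+ 2 <= u / (1 + u).
  rewrite ler_pdivlMr //.
  have -> : (u - 2 * u ^+ 2) * (1 + u) = u - u ^+ 2 * (1 + 2 * u) by ring.
  rewrite lerBlDr lerDl mulr_ge0 ?sqr_ge0 //; lra.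
rewrite ler_norml; apply/andP; split; first by lra.
by have := sqr_ge0 u; lra.
Qed.

Lemma sum_telescope_sqr m n : (3 <= m)%N -> (m <= n)%N ->
  \sum_(m <= j < n) ((j%:R - 2)^-1 - (j%:R - 1)^-1 : R) <= (m%:R - 2)^-1.
Proof.
move=> m3 mn; have pos k : (m <= k)%N -> 0 < k%:R - 2 :> R.
  by move=> mk; rewrite subr_gt0 ltr_nat; apply: leq_trans mk.
have e : \sum_(m <= j < n) ((j%:R - 2)^-1 - (j%:R - 1)^-1 : R) =
    (m%:R - 2)^-1 - (n%:R - 2)^-1.
  rewrite -(subnKC mn); elim: (n - m)%N => [|d IH].
    by rewrite addn0 big_geq // subrr.
  rewrite addnS big_nat_recr ?leq_addr //= IH -[(m + d).+1%:R]natr1.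
  rewrite (_ : (m + d)%:R + 1 - 2 = (m + d)%:R - 1 :> R); last by ring.
  ring.
by rewrite e gerBl invr_ge0 ltW // pos.
Qed.

Variables (g : pred nat) (e : nat -> int) (K : nat).
Hypothesis e_norm : forall j, `|(e j)%:~R : R| <= 1.
Hypothesis g_prime : forall j, (K < j)%N -> g j = prime j.
Hypothesis e_chi4 : forall j, (K < j)%N -> prime j -> e j = chi4 j.

Let u (j : nat) : R := if g j then - (e j)%:~R / (j%:R - 1) else 0.

Lemma factor_norm j : (3 <= j)%N -> `|u j| <= (j%:R - 1)^-1.
Proof.
move=> j3; have j1 : 0 < j%:R - 1 :> R.
  by rewrite subr_gt0 ltr1n; apply: leq_trans j3.
rewrite /u; case: ifP => _; last by rewrite normr0 invr_ge0 ltW.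
rewrite normrM normrN [X in _ * X]ger0_norm ?invr_ge0 ?(ltW j1) //.
by rewrite -[leRHS]mul1r ler_wpM2r // invr_ge0 ltW.
Qed.

Lemma factor_ge j : (3 <= j)%N -> - 2^-1 <= u j.
Proof.
move=> j3; have := factor_norm j3; rewrite ler_norml => /andP[h _].
apply: le_trans h; rewrite lerN2 lef_pV2 ?posrE //.
  by rewrite lerBrDr (_ : 2 + 1 = 3%:R :> R) ?ler_nat //; ring.
by rewrite subr_gt0 ltr1n; apply: leq_trans j3.
Qed.

(** The logarithm of the factor at a large prime [p] differs from [- chi p / p] by
    the term of a convergent series. *)
Lemma ln_factor j : (K < j)%N -> (3 <= j)%N ->
  `|ln (1 + u j) + (if prime j then chi j / j%:R else 0)| <=
  3 * ((j%:R - 2)^-1 - (j%:R - 1)^-1).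
Proof.
move=> Kj j3; have j3R : 3%:R <= j%:R :> R by rewrite ler_nat.
have h1 := ln1D_bounds (factor_ge j3).
have sq : u j ^+ 2 <= (j%:R - 1)^-1 ^+ 2.
  rewrite -[leLHS]real_normK ?num_real // lerXn2r ?nnegrE ?normr_ge0 ?factor_norm //.
  by rewrite invr_ge0; lra.
have h2 : `|u j + (if prime j then chi j / j%:R else 0)| <= (j%:R * (j%:R - 1))^-1.
  rewrite /u g_prime //; case: ifP => j_pr; last first.
    by rewrite addr0 normr0 invr_ge0 mulr_ge0 //; lra.
  rewrite (e_chi4 Kj j_pr).
  have -> : - chi j / (j%:R - 1) + chi j / j%:R = - chi j * (j%:R * (j%:R - 1))^-1.
    by field; rewrite !gt_eqF //; lra.
  have q0 : 0 <= (j%:R * (j%:R - 1))^-1 :> R.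
    by rewrite invr_ge0 mulr_ge0 //; lra.
  rewrite normrM normrN [X in _ * X]ger0_norm // -[leRHS]mul1r.
  by rewrite ler_wpM2r // chi4_norm.
have -> : ln (1 + u j) + (if prime j then chi j / j%:R else 0) =
  (ln (1 + u j) - u j) + (u j + (if prime j then chi j / j%:R else 0)) by ring.
apply: (le_trans (ler_normD _ _)).
apply: (@le_trans _ _ (2 * (j%:R - 1)^-1 ^+ 2 + (j%:R * (j%:R - 1))^-1)).
  apply: lerD => //; apply: (le_trans h1); exact: ler_wpM2l.
set t := j%:R in j3R *.
rewrite -subr_ge0.
have -> : 3 * ((t - 2)^-1 - (t - 1)^-1) - (2 * (t - 1)^-1 ^+ 2 + (t * (t - 1))^-1) =
  (t * 3 * (t - 1) - 2 * t * (t - 2) - (t - 1) * (t - 2)) / (t * (t - 1) ^+ 2 * (t - 2)).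
  by field; rewrite !gt_eqF //; lra.
apply: divr_ge0; first by nra.
by apply: mulr_ge0; [apply: mulr_ge0|]; rewrite ?sqr_ge0; lra.
Qed.

(** The right-hand side tends to 0 as [m] grows: this is Cauchy's criterion for the
    logarithm of the product. *)
Lemma sum_ln_factor m n : (K < m)%N -> (3 <= m)%N -> (m <= n)%N ->
  `|\sum_(m <= j < n) ln (1 + u j)| <= 28 / ln m%:R + 3 / (m%:R - 2).
Proof.
move=> Km m3 mn.
have -> : \sum_(m <= j < n) ln (1 + u j) =
   \sum_(m <= j < n) (ln (1 + u j) + (if prime j then chi j / j%:R else 0))
   - \sum_(m <= p < n | prime p) chi p / p%:R.
  by rewrite [X in _ = _ - X]big_mkcond -sumrB; apply: eq_bigr => j _; rewrite addrK.
apply: (le_trans (ler_normB _ _)); rewrite addrC; apply: lerD.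
  by apply: sum_chi4_primes => //; apply: ltnW.
apply: (le_trans (ler_norm_sum _ _ _)).
apply: (@le_trans _ _ (\sum_(m <= j < n) 3 * ((j%:R - 2)^-1 - (j%:R - 1)^-1 : R))).
  rewrite !big_nat; apply: ler_sum => j /andP[mj _].
  by apply: ln_factor; [apply: leq_trans mj|apply: leq_trans mj].
by rewrite -mulr_sumr; apply: ler_wpM2l => //; apply: sum_telescope_sqr.
Qed.

Theorem euler_product_cvg : exists2 l : R, 0 < l &
  (fun n => \prod_(3 <= p < n | g p) (1 - (e p)%:~R / (p%:R - 1))) @ \oo --> l.
Proof.
pose v j : R := if (j < 3)%N then 0 else ln (1 + u j).
have vs m n : (3 <= m)%N -> \sum_(m <= j < n) v j = \sum_(m <= j < n) ln (1 + u j).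
  move=> m3; apply: eq_big_nat => j /andP[mj _].
  by rewrite /v ltnNge (leq_trans m3 mj).
have cv : cvg (series v @ \oo).
  apply/cauchy_cvgP/cauchy_seriesP => eps eps0.
  have [N hN] : exists N, forall m, (N <= m)%N ->
      28 / ln m%:R + 3 / (m%:R - 2) < eps :> R.
    have [N1 _ h1] := nbhs_infty_gtr (expR (56 / eps)).
    have [N2 _ h2] := nbhs_infty_gtr (6 / eps + 2).
    exists (N1 + N2)%N => m mN.
    have H1 : expR (56 / eps) < m%:R.
      by apply: h1; rewrite /=; apply: leq_trans mN; apply: leq_addr.
    have H2 : 6 / eps + 2 < m%:R.
      by apply: h2; rewrite /=; apply: leq_trans mN; apply: leq_addl.
    have m0 : 0 < m%:R :> R by apply: lt_trans H1; apply: expR_gt0.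
    have L1 : 56 / eps < ln m%:R by rewrite -[ltLHS]expRK ltr_ln ?posrE ?expR_gt0.
    have L0 : 0 < ln m%:R :> R by apply: lt_trans L1; rewrite divr_gt0.
    have T0 : 0 < m%:R - 2 :> R.
      by rewrite subr_gt0; apply: lt_trans H2; rewrite ltrDr divr_gt0.
    have A1 : 28 / ln m%:R < eps / 2.
      by move: L1; rewrite !ltr_pdivrMr //; lra.
    have A2 : 3 / (m%:R - 2) < eps / 2.
      by move: H2; rewrite -ltrBrDr !ltr_pdivrMr //; lra.
    by lra.
  pose M := (N + K.+1 + 3)%N.
  exists ([set m | (M <= m)%N], [set m | (M <= m)%N]) => /=.
    by split; apply: nbhs_infty_ge.
  move=> [m n] /= [Mm _]; have [mn|nm] := leqP m n; last first.
    by rewrite big_geq ?normr0 // ltnW.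
  have m3 : (3 <= m)%N by rewrite /M in Mm; lia.
  rewrite vs //; apply: (@le_lt_trans _ _ (28 / ln m%:R + 3 / (m%:R - 2))).
    by apply: sum_ln_factor => //; rewrite /M in Mm; lia.
  by apply: hN; rewrite /M in Mm; lia.
pose S : R := limn (series v); have hS : series v @ \oo --> S := cv.
exists (expR S); first exact: expR_gt0.
have hE : (expR \o series v) @ \oo --> expR S.
  by apply: continuous_cvg => //; apply: continuous_expR.
apply: cvg_trans hE; apply: near_eq_cvg; near=> n.
have n3 : (3 <= n)%N by near: n; apply: nbhs_infty_ge.
rewrite /= /series /= (@big_cat_nat _ _ _ 3) //= big_nat big1 ?add0r; last first.
  by move=> i /andP[_ i3]; rewrite /v i3.
rewrite vs // [RHS]big_mkcond.
have factor_gt0 j : (3 <= j)%N -> 0 < 1 + u j.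
  by move=> /factor_ge; lra.
rewrite -(subnKC n3); elim: (n - 3)%N => [|d IH].
  by rewrite addn0 !big_geq // expR0.
rewrite addnS !(big_nat_recr (3 + d)%N) ?leq_addr //= expRD IH lnK ?posrE ?factor_gt0 ?leq_addr //.
by congr (_ * _); rewrite /u; case: ifP => _; rewrite ?mulNr ?addr0.
Unshelve. all: by end_near.
Qed.

End EulerProduct.

(** * The Hardy-Littlewood constant of a residue class *)

Lemma ex_sqrtN1_Fp (p : nat) : prime p -> (p %% 4 = 1)%N ->
  exists f : 'F_p, f ^+ 2 = -1.
Proof.
move=> p_pr p1; have [rs [rs_uniq rs_size rs0]] := nonzero_elements 'F_p.
rewrite card_Fp // in rs_size.
have p_gt1 := prime_gt1 p_pr.
have : has (p.-1).-primitive_root rs.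
  apply: has_prim_root; rewrite ?rs_size //; first by lia.
  apply/allP => x /(allP rs0)/= x0; rewrite unity_rootE.
  by have := expf_pred_card x0; rewrite card_Fp // => ->.
move=> /hasP[z _ z_prim]; exists (z ^+ (p.-1 %/ 4)); apply: qprim_sqr.
by apply: (dvdn_prim_root z_prim); lia.
Qed.

Lemma legendre_range d p :
  [\/ legendre d p = 0, legendre d p = 1 | legendre d p = -1].
Proof.
rewrite /legendre; case: ifP => _; first by constructor 1.
by case: ifP => _; [constructor 2|constructor 3].
Qed.

(** The discriminant is minus a square, and -1 is a square modulo [p] exactly when
    [p] is 1 modulo 4. *)
Lemma legendre_neg_sqr (k : int) (p : nat) : prime p -> odd p ->
  ~~ (p%:Z %| k)%Z -> legendre (- k ^+ 2) p = chi4 p.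
Proof.
move=> p_pr p_odd pk; rewrite /legendre.
have -> : (p%:Z %| - k ^+ 2)%Z = false.
  by apply/negbTE; rewrite dvdzE abszN abszX /= Euclid_dvdX // andbT.
have k0 : k%:~R != 0 :> 'F_p by rewrite Fp_int_eq0.
have two0 : 2%:R != 0 :> 'F_p.
  by rewrite Fp_nat_eq0 // dvdn_prime2 //; apply: contraTneq p_odd => ->.
have -> : [exists x : 'F_p, x ^+ 2 == (- k ^+ 2)%:~R] = (p %% 4 == 1)%N.
  apply/existsP/eqP => [[x /eqP xk]|p1].
    have : (x / k%:~R) ^+ 2 = -1.
      by rewrite expr_div_n xk rmorphN rmorphXn mulNr divff // expf_neq0.
    move=> /(sqrN1_prim two0)/dvdn4_pred_card; rewrite card_Fp //.
    by have := prime_gt0 p_pr; lia.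
  have [f f2] := ex_sqrtN1_Fp p_pr p1; exists (f * k%:~R).
  by rewrite exprMn f2 rmorphN rmorphXn /= mulN1r.
by rewrite /chi4 p_odd.
Qed.

Section ClassAsymptotics.

Variables (R : realType) (alpha : int) (M : nat).
Hypotheses (alpha0 : alpha != 0) (M_gt0 : (0 < M)%N) (M_even : ~~ odd M).

Local Open Scope classical_set_scope.

Let a : int := M%:Z ^+ 2.
Let b (r : nat) : int := 2 * M%:Z * r%:Z.
Let c (r : nat) : int := r%:Z ^+ 2 + alpha ^+ 2.

Lemma discr_class r : discr a (b r) (c r) = - (2 * M%:Z * alpha) ^+ 2.
Proof. by rewrite /discr /a /b /c; ring. Qed.

Let M0 : M%:Z != 0. Proof. by rewrite eqz_nat -lt0n. Qed.

Lemma HL_partial_product_class r :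
  HL_partial_product R a (b r) (c r) = HL_partial_product R a (b 0) (c 0).
Proof. by rewrite /HL_partial_product !discr_class. Qed.

Lemma HL_common_factor_class r :
  HL_common_factor R a (b r) = HL_common_factor R a (b 0).
Proof.
rewrite /HL_common_factor; apply: eq_bigl => p.
case: (boolP (prime p)) => //= p_pr; case: (boolP (_ %| a)%Z) => //= pa.
have pM : (p%:Z %| M%:Z)%Z.
  by move: pa; rewrite /a !dvdzE abszX /= Euclid_dvdX // => /andP[].
by rewrite /b !(dvdz_mulr _ (dvdz_mull _ pM)).
Qed.

Lemma HL_common_factor_gt0 r : 0 < HL_common_factor R a (b r).
Proof.
rewrite /HL_common_factor; elim/big_ind: _ => //; first by move=> x y; exact: mulr_gt0.
move=> p /and3P[p_pr _ _]; have p1 := prime_gt1 p_pr.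
by rewrite divr_gt0 ?ltr0n ?prime_gt0 // subr_gt0 ltr1n.
Qed.

(** The factors agree with those of the product over all primes, with the
    character [chi4], except at the divisors of [2 * M * alpha]. *)
Lemma HL_product_gt0 r : 0 < limn (HL_partial_product R a (b r) (c r)).
Proof.
rewrite /HL_partial_product discr_class.
set k := 2 * M%:Z * alpha.
have k0 : (0 < `|k|)%N by rewrite absz_gt0 /k !mulf_neq0.
have Mk : (M <= `|k|)%N.
  by rewrite /k !abszM /= mulnAC leq_pmull // muln_gt0 absz_gt0 alpha0.
have k2 : (2 <= `|k|)%N.
  by rewrite /k !abszM /= -mulnA leq_pmulr // muln_gt0 M_gt0 absz_gt0.
have [||j Kj j_pr|l l0 hl] := @euler_product_cvg R
    (fun p => prime p && ~~ (p%:Z %| a)%Z) (legendre (- k ^+ 2)) `|k|%N.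
- by move=> j; case: (legendre_range (- k ^+ 2) j) => ->;
    rewrite ?normr0 ?rmorphN1 ?normrN ?normr1.
- move=> j Kj /=; case: (boolP (prime j)) => //= j_pr.
  apply: contraTN Kj; rewrite /a dvdzE abszX /= Euclid_dvdX // => /andP[jM _].
  by rewrite -leqNgt; apply: leq_trans Mk; apply: dvdn_leq.
- apply: legendre_neg_sqr => //.
    case: (even_prime j_pr) => // j2; move: Kj; rewrite j2.
    by rewrite ltnNge k2.
  by rewrite dvdzE; apply: contraTN Kj => /(dvdn_leq k0); rewrite -leqNgt.
by rewrite (cvg_lim _ hl).
Qed.

Lemma HL_delta_class r :
  HL_delta R a (b r) (c r) = HL_delta R a (b 0) (c 0).
Proof.
rewrite /HL_delta HL_partial_product_class HL_common_factor_class.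
have ev s : gcdz 2 (a + b s) = 2.
  have -> : a + b s = 2 * (M%:Z * M./2%:Z + M%:Z * s%:Z).
    have hE : M%:Z = 2 * M./2%:Z by rewrite -PoszM mul2n (even_halfK M_even).
    by rewrite /a /b expr2 {1}hE; ring.
  by rewrite /gcdz abszM /= gcdnMr.
by rewrite !ev.
Qed.

Lemma HL_delta_gt0 r : 0 < HL_delta R a (b r) (c r).
Proof.
rewrite /HL_delta !mulr_gt0 ?HL_common_factor_gt0 ?HL_product_gt0 //.
  by rewrite ltr0z /gcdz ltz_nat gcdn_gt0.
by rewrite invr_gt0 sqrtr_gt0 ltr0z exprn_gt0 // ltz_nat.
Qed.

Lemma equiv_div_cvg (f g : nat -> R) (k : R) : f ~_\oo (fun n => k * g n) ->
  (\forall n \near \oo, 0 < g n) -> (fun n => f n / g n) @ \oo --> k.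
Proof.
move=> fg g_gt0; apply/cvgrPdist_le => eps eps0.
have : (f - (fun n => k * g n)) =o_\oo (fun n => k * g n).
  by rewrite {1}fg addrC addKr.
have d0 : 0 < eps / (`|k| + 1) by rewrite divr_gt0 // ltr_wpDl.
move=> /eqoP/(_ _ d0) h; near=> n.
have gn : 0 < g n by near: n.
have -> : k - f n / g n = - ((f n - k * g n) / g n) by field; rewrite gt_eqF.
rewrite normrN normrM [X in _ * X]ger0_norm ?invr_ge0 ?(ltW gn) // ler_pdivrMr //.
have : `|f n - k * g n| <= eps / (`|k| + 1) * `|k * g n| by near: n; exact: h.
move/le_trans; apply; rewrite normrM (gtr0_norm gn) mulrA ler_pM2r //.
rewrite mulrAC ler_pdivrMr ?ltr_wpDl //.
by rewrite ler_pM2l // lerDl.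
Unshelve. all: by end_near.
Qed.

(** The constant [delta] does not depend on [r]: it involves only [M] and the
    discriminant. *)
Lemma quad_primes_class (hHL : Hardy_Littlewood R) : exists2 delta : R, 0 < delta &
  forall r : nat, ~~ odd r -> coprime `|c r|%N M ->
    (fun n => (quad_primes a (b r) (c r) n)%:R / (Num.sqrt n%:R / ln n%:R : R))
      @ \oo --> delta.
Proof.
exists (HL_delta R a (b 0) (c 0)); first exact: HL_delta_gt0.
move=> r r_even cM; rewrite -(HL_delta_class r); apply: equiv_div_cvg.
  apply: hHL.
  - by rewrite /a exprn_gt0 // ltz_nat.
  - rewrite /gcdz /= gcdnAC; congr Posz; apply/eqP.
    suff -> : gcdn `|a| `|c r| = 1%N by rewrite gcd1n.
    by apply/eqP; rewrite -/(coprime _ _) /a abszX coprimeXl // coprime_sym.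
  - case=> _; rewrite dvdzE /= dvdn2 => ec.
    move: cM; rewrite /coprime => /eqP e1.
    have : (2 %| gcdn `|c r| M)%N by rewrite dvdn_gcd !dvdn2 ec M_even.
    by rewrite e1.
  - rewrite discr_class => -[k kE].
    have k0 : 2 * M%:Z * alpha != 0 by rewrite !mulf_neq0.
    have : 0 < (2 * M%:Z * alpha) ^+ 2 by rewrite exprn_even_gt0.
    by have := sqr_ge0 k; rewrite -kE; lia.
near=> n; have n2 : (2 <= n)%N by near: n; exact: nbhs_infty_ge.
by rewrite divr_gt0 ?sqrtr_gt0 ?ltr0n ?(ltnW n2) // ln_gt0 // ltr1n.
Unshelve. all: by end_near.
Qed.

End ClassAsymptotics.

(** * Equidistribution of the quartic symbol in residue classes *)

Lemma sqsum_nat alpha x : sqsum alpha x = (`|alpha| ^ 2 + x ^ 2)%N.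
Proof.
apply/eqP; rewrite -eqz_nat /sqsum gez0_abs ?addr_ge0 ?sqr_ge0 //.
by rewrite PoszD -!rmorphXn /= -abszX gez0_abs ?sqr_ge0 // natz.
Qed.

Lemma sqsum_inj alpha : injective (sqsum alpha).
Proof. by move=> x y; rewrite !sqsum_nat => /addnI/eqP; rewrite eqn_exp2r // => /eqP. Qed.

Lemma sqsum_coprime_mod alpha d x y : x = y %[mod d] ->
  coprime (sqsum alpha x) d = coprime (sqsum alpha y) d.
Proof.
move=> xy; rewrite -coprime_modl -[RHS]coprime_modl !sqsum_nat.
by rewrite -modnDmr -[in RHS]modnDmr -modnXm xy modnXm.
Qed.

Section Classes.

Variables (alpha D : int) (d u : nat).
Hypotheses (alpha1 : (4 %| alpha - 1)%Z) (d_odd : odd d).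

Let M := (8 * d)%N.

(** The values of [sqsum alpha] on the other classes are even or have a fixed
    common factor with [d]. *)
Definition admissible (r : nat) : bool :=
  ~~ odd r && coprime (sqsum alpha r) d.

Lemma class_modulus_gt0 : (0 < M)%N.
Proof. by rewrite /M muln_gt0 /= odd_gt0. Qed.

Lemma admissible_mod x y : x = y %[mod 2 * d] -> admissible x = admissible y.
Proof.
move=> xy; rewrite /admissible; congr (~~ _ && _).
  have := eqmod_dvd (dvdn_mulr d (dvdnn 2)) xy; rewrite !modn2.
  by case: odd; case: odd.
exact: sqsum_coprime_mod (eqmod_dvd (dvdn_mull 2 (dvdnn d)) xy).
Qed.

Lemma dvdn_class_modulus : (2 * d %| M)%N.
Proof. by apply/dvdnP; exists 4%N; rewrite /M mulnA. Qed.

(** For the primes dividing [d] but not [alpha] take [r] divisible by them, and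
    not divisible by the others. *)
Lemma ex_admissible : exists r : 'I_M, admissible r.
Proof.
pose P : nat_pred := [pred l | ~~ (l %| `|alpha|)%N].
pose r := (2 * d`_P)%N; have d0 : (0 < d)%N by exact: odd_gt0.
exists (Ordinal (ltn_pmod r class_modulus_gt0)) => /=.
rewrite (@admissible_mod _ r); last by rewrite modn_dvdm // dvdn_class_modulus.
have alpha0 : (0 < `|alpha|)%N by rewrite absz_gt0; case/dvdzP: alpha1 => k ?; lia.
rewrite /admissible oddM /= sqsum_nat coprime_has_primes ?addn_gt0 ?expn_gt0 ?alpha0 //.
apply/hasPn => l; rewrite mem_primes => /and3P[l_pr _ ld].
rewrite /= mem_primes !negb_and l_pr /=; apply/orP; right.
have l_odd := odd_dvd d_odd ld.
have lr : (l %| r)%N = ~~ (l %| `|alpha|)%N.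
  rewrite /r Euclid_dvdM // (dvdn_prime2 l_pr) //.
  have -> : (l == 2)%N = false by apply: contraTF l_odd => /eqP ->.
  have := primes_part P d => /(congr1 (fun s => l \in s)).
  rewrite mem_filter !mem_primes l_pr ld part_gt0 d0 /= => ->.
  by rewrite andbT inE.
have [la|la] := boolP (l %| `|alpha|)%N.
  rewrite dvdn_addr; last by rewrite Euclid_dvdX // la.
  by rewrite Euclid_dvdX // lr la.
rewrite dvdn_addl; last by rewrite Euclid_dvdX // lr la.
by rewrite Euclid_dvdX // (negPf la).
Qed.

(** The lower bound excludes the prime divisors of [2 * D] and of the modulus. *)
Definition large_prime (x : nat) : bool :=
  two_square_prime alpha x && (maxn M (absz (2 * D)%R) < sqsum alpha x)%N.

Lemma large_prime_two_square x : large_prime x -> two_square_prime alpha x.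
Proof. by case/andP. Qed.

Hypothesis D0 : D != 0.

Lemma large_ndvd_2D p : (maxn M (absz (2 * D)%R) < p)%N -> ~~ (p%:Z %| 2 * D)%Z.
Proof.
rewrite gtn_max => /andP[_ pD]; rewrite dvdzE; apply: contraTN pD => /dvdn_leq.
by rewrite -leqNgt; apply; rewrite absz_gt0 mulf_neq0.
Qed.

Lemma large_prime_ndvd x : large_prime x -> ~~ ((sqsum alpha x)%:Z %| D)%Z.
Proof.
by move=> /andP[_ /large_ndvd_2D]; apply: contra => h; rewrite dvdz_mull.
Qed.

Hypothesis u_odd : odd u.
Hypothesis shift : forall x1 x2 : nat,
  two_square_prime alpha x1 -> two_square_prime alpha x2 ->
  ~~ ((sqsum alpha x1)%:Z %| D)%Z -> ~~ ((sqsum alpha x2)%:Z %| D)%Z ->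
  x1 = x2 %[mod d] ->
  qsym alpha x1 D + u * x1./2 = qsym alpha x2 D + u * x2./2 %[mod 4].

Hypothesis populated : forall r : nat, (r < M)%N -> admissible r ->
  exists2 x, large_prime x & (x %% M)%N = r.

(** A single large prime decides to which set its class belongs, because the
    symbol of [D] is constant on a class ([qsym_class]). *)
Definition symbol_class (e : nat) : {set 'I_M} :=
  [set r : 'I_M | `[< exists2 x, large_prime x &
     (x %% M)%N = r /\ qsym alpha x D = e >] && admissible r].

Lemma half_congr (h x1 x2 : nat) : ~~ odd x1 -> ~~ odd x2 ->
  x1 + 2 * h = x2 %[mod M] -> x1./2 + h = x2./2 %[mod 4].
Proof.
move=> e1 e2 h12.
have : (x1 + 2 * h = x2 %[mod 8])%N by apply: eqmod_dvd h12; rewrite dvdn_mulr.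
by clear -e1 e2; lia.
Qed.

(** Adding [2 * h] to [x] adds [h] to [x / 2]; a multiple of [d] is taken for [h]
    so that [x] does not change modulo [d]. *)
Lemma large_prime_shift (h x1 x2 : nat) : large_prime x1 -> large_prime x2 ->
  (d %| h)%N -> x1 + 2 * h = x2 %[mod M] ->
  qsym alpha x1 D = qsym alpha x2 D + u * h %[mod 4].
Proof.
move=> P1 P2 dh h12.
have /andP[e1 _] := large_prime_two_square P1.
have /andP[e2 _] := large_prime_two_square P2.
have hd : x1 = x2 %[mod d].
  rewrite -(eqmod_dvd (dvdn_mull 8 (dvdnn d)) h12) -modnDmr -modnMmr.
  by move: dh => /eqP ->; rewrite muln0 mod0n addn0.
have := shift (large_prime_two_square P1) (large_prime_two_square P2)
  (large_prime_ndvd P1) (large_prime_ndvd P2) hd.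
have := half_congr e1 e2 h12.
move: (qsym alpha x1 D) (qsym alpha x2 D) (x1./2) (x2./2) => q1 q2 y1 y2 hy hq.
have : (u * y2 = u * y1 + u * h %[mod 4])%N.
  by rewrite -mulnDr -modnMmr -hy modnMmr.
move: hq; move: (u * y1)%N (u * y2)%N (u * h)%N => a b c; clear; lia.
Qed.

Lemma qsym_class x1 x2 : large_prime x1 -> large_prime x2 -> x1 = x2 %[mod M] ->
  qsym alpha x1 D = qsym alpha x2 D.
Proof.
move=> P1 P2 h12; have := @large_prime_shift 0 x1 x2 P1 P2 (dvdn0 d).
rewrite !muln0 !addn0 => /(_ h12).
by rewrite !modn_small ?qsym_lt4.
Qed.

Lemma symbol_classP (x e : nat) (r : 'I_M) : large_prime x -> admissible r ->
  (x %% M)%N = r -> (r \in symbol_class e) = (qsym alpha x D == e).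
Proof.
move=> Px adm xr; rewrite inE adm andbT; apply/asboolP/eqP => [[y Py [yr <-]]|<-].
  by apply: qsym_class => //; rewrite xr yr.
by exists x.
Qed.

Definition shift_class (r : 'I_M) : 'I_M :=
  Ordinal (ltn_pmod (r + 2 * d) class_modulus_gt0).

Lemma shift_class_inj : injective shift_class.
Proof.
move=> r s /(congr1 val)/= /eqP; rewrite eqn_modDr => /eqP e.
by apply: val_inj; rewrite -[LHS](modn_small (ltn_ord r)) e modn_small.
Qed.

Lemma admissible_shift (r : 'I_M) : admissible (shift_class r) = admissible r.
Proof.
by apply: admissible_mod; rewrite /= modn_dvdm ?dvdn_class_modulus // modnDr.
Qed.

Lemma card_symbol_class_shift e : (e < 4)%N ->
  (#|symbol_class e| <= #|symbol_class ((e + 3 * (u * d)) %% 4)|)%N.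
Proof.
move=> e4; rewrite -(card_imset _ shift_class_inj); apply: subset_leq_card.
apply/fintype.subsetP => s /imsetP[r]; rewrite inE => /andP[/asboolP[x Px [xr qx]] adm] ->.
have adm' : admissible (shift_class r) by rewrite admissible_shift.
have [y Py yr] := populated (ltn_ord (shift_class r)) adm'.
rewrite (symbol_classP _ Py adm' yr); apply/eqP.
have h : x + 2 * d = y %[mod M].
  by rewrite yr /= -xr modnDml.
have := large_prime_shift Px Py (dvdnn d) h; rewrite qx => {}h.
have := qsym_lt4 alpha y D; move: h; move: (qsym alpha y D) (u * d)%N => q t.
clear -e4; lia.
Qed.

Lemma card_symbol_class_eq e1 e2 : (e1 < 4)%N -> (e2 < 4)%N ->
  #|symbol_class e1| = #|symbol_class e2|.
Proof.
move=> h1 h2.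
have o : odd (u * d)%N by rewrite oddM u_odd.
have st (e f : nat) : (e < 4)%N -> f = ((e + 3 * (u * d)) %% 4)%N ->
    (#|symbol_class e| <= #|symbol_class f|)%N.
  by move=> e4 ->; apply: card_symbol_class_shift.
have [t|t] : ((u * d) %% 4 = 1 \/ (u * d) %% 4 = 3)%N by move: o; clear; lia.
- have a0 : (#|symbol_class 0| <= #|symbol_class 3|)%N by apply: st => //; move: t; clear; lia.
  have a1 : (#|symbol_class 1| <= #|symbol_class 0|)%N by apply: st => //; move: t; clear; lia.
  have a2 : (#|symbol_class 2| <= #|symbol_class 1|)%N by apply: st => //; move: t; clear; lia.
  have a3 : (#|symbol_class 3| <= #|symbol_class 2|)%N by apply: st => //; move: t; clear; lia.
  by case: e1 h1 => [|[|[|[|//]]]] _; case: e2 h2 => [|[|[|[|//]]]] _; lia.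
- have a0 : (#|symbol_class 0| <= #|symbol_class 1|)%N by apply: st => //; move: t; clear; lia.
  have a1 : (#|symbol_class 1| <= #|symbol_class 2|)%N by apply: st => //; move: t; clear; lia.
  have a2 : (#|symbol_class 2| <= #|symbol_class 3|)%N by apply: st => //; move: t; clear; lia.
  have a3 : (#|symbol_class 3| <= #|symbol_class 0|)%N by apply: st => //; move: t; clear; lia.
  by case: e1 h1 => [|[|[|[|//]]]] _; case: e2 h2 => [|[|[|[|//]]]] _; lia.
Qed.

(** Translation by [2 * d] permutes the admissible classes and the four values of
    the symbol cyclically, so that the values are equally frequent. *)
Lemma card_admissible e : (e < 4)%N ->
  #|[set r : 'I_M | admissible r]| = (4 * #|symbol_class e|)%N.
Proof.
move=> e4.
have -> : #|[set r : 'I_M | admissible r]| = (\sum_(f < 4) #|symbol_class f|)%N.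
  rewrite -sum1_card.
  under [RHS]eq_bigr do rewrite -sum1_card big_mkcond.
  rewrite exchange_big /= big_mkcond; apply: eq_bigr => r _; rewrite inE.
  case: (boolP (admissible r)) => adm; last first.
    by rewrite big1 // => f _; rewrite inE (negPf adm) andbF.
  have [x Px xr] := populated (ltn_ord r) adm.
  rewrite (bigD1 (Ordinal (qsym_lt4 alpha x D))) //= (symbol_classP _ Px adm xr) eqxx.
  rewrite big1 // => f fx; rewrite (symbol_classP _ Px adm xr).
  by case: eqP => // fe; case/eqP: fx; apply: val_inj.
rewrite (eq_bigr (fun=> #|symbol_class e|)); last first.
  by move=> f _; apply: card_symbol_class_eq.
by rewrite sum_nat_const card_ord.
Qed.

End Classes.

(** * Counting primes by residue classes *)

Section Counting.

Variables (alpha D : int) (d : nat).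
Hypotheses (alpha1 : (4 %| alpha - 1)%Z) (d_odd : odd d) (D0 : D != 0).

Let M := (8 * d)%N.

Definition class_prime (r p : nat) : bool := prime p &&
  `[< exists x : nat, p%:Z = M%:Z ^+ 2 * x%:Z ^+ 2 + 2 * M%:Z * r%:Z * x%:Z +
        (r%:Z ^+ 2 + alpha ^+ 2) >].

Lemma class_primeP r p : reflect
  (prime p /\ exists x, p = sqsum alpha (M * x + r)) (class_prime r p).
Proof.
have e x : (sqsum alpha (M * x + r))%:Z = M%:Z ^+ 2 * x%:Z ^+ 2 +
    2 * M%:Z * r%:Z * x%:Z + (r%:Z ^+ 2 + alpha ^+ 2).
  by rewrite sqsumE PoszD PoszM; ring.
apply: (iffP andP) => -[p_pr].
  move=> /asboolP[x xE]; split=> //; exists x.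
  by apply/eqP; rewrite -eqz_nat xE -e.
by move=> [x xE]; split=> //; apply/asboolP; exists x; rewrite -e xE.
Qed.

Lemma card_pred_ord (P : pred nat) n :
  #|[pred p : 'I_n | P p]| = (\sum_(0 <= p < n) P p)%N.
Proof.
rewrite -sum1_card big_mkcond /= big_mkord; apply: eq_bigr => i _.
by rewrite inE; case: (P i).
Qed.

Lemma quad_primesE r n :
  quad_primes (M%:Z ^+ 2) (2 * M%:Z * r%:Z) (r%:Z ^+ 2 + alpha ^+ 2) n =
  (\sum_(0 <= p < n) class_prime r p)%N.
Proof. by rewrite /quad_primes -card_pred_ord. Qed.

(** A prime has only one class, as it determines [x]. *)
Lemma sum_class_prime (A : {set 'I_M}) (p x : nat) : prime p ->
  p = sqsum alpha x ->
  (\sum_(r in A) class_prime r p = (Ordinal (ltn_pmod x (class_modulus_gt0 d_odd)) \in A))%N.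
Proof.
move=> p_pr px; set r0 := Ordinal _.
have e (r : 'I_M) : class_prime r p = (r == r0).
  apply/class_primeP/eqP => [[_ [y]]|->].
    rewrite px => /sqsum_inj xE; apply: val_inj.
    by rewrite /= xE mulnC modnMDl modn_small.
  by split=> //; exists (x %/ M)%N; rewrite /= mulnC -divn_eq.
under eq_bigr do rewrite e.
rewrite big_mkcond (bigD1 r0) //= eqxx big1 ?addn0; first by case: (_ \in _).
by move=> r /negPf->; case: ifP.
Qed.

Lemma sum_class_prime0 (A : {set 'I_M}) (p : nat) :
  (forall x, p <> sqsum alpha x) -> (\sum_(r in A) class_prime r p = 0)%N.
Proof.
move=> no; rewrite big1 // => r _; apply/eqP; rewrite eqb0.
by apply/class_primeP => -[_ [x /no]].
Qed.

Lemma inQP (p : nat) : reflect (prime p /\ exists x, p = sqsum alpha x) (inQ alpha p).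
Proof.
apply: (iffP andP) => -[p_pr].
  move=> /asboolP[x xE]; split=> //; exists `|x|%N; apply/eqP.
  by rewrite -eqz_nat xE sqsumE abszE real_normK ?num_real.
by move=> [x xE]; split=> //; apply/asboolP; exists x%:Z; rewrite -sqsumE xE.
Qed.

Let bound := maxn M (absz (2 * D)).

Lemma large_prime_sqsum x : prime (sqsum alpha x) -> (bound < sqsum alpha x)%N ->
  large_prime alpha D d x /\ admissible alpha d (x %% M).
Proof.
move=> p_pr pB; have pM : (M < sqsum alpha x)%N by apply: leq_ltn_trans pB; apply: leq_maxl.
have d0 := odd_gt0 d_odd.
have p_odd : odd (sqsum alpha x).
  by have [p2|//] := even_prime p_pr; move: pM; rewrite p2 /M; lia.
have x_even : ~~ odd x.
  have ao : odd `|alpha|%N by case/dvdzP: alpha1 => a ea; lia.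
  by move: p_odd; rewrite sqsum_nat oddD !oddX /= ao.
split; first by rewrite /large_prime /two_square_prime x_even p_pr.
rewrite (@admissible_mod alpha d _ x); last by rewrite modn_dvdm ?dvdn_class_modulus.
rewrite /admissible x_even prime_coprime //; apply/negP => /(dvdn_leq d0).
by move: pM; rewrite /M; lia.
Qed.

Definition admissible_set : {set 'I_M} := [set r : 'I_M | admissible alpha d r].

Lemma inQ_classes p : (bound < p)%N ->
  inQ alpha p = (\sum_(r in admissible_set) class_prime r p)%N :> nat.
Proof.
move=> pB; case: inQP => [[p_pr [x px]]|no].
  rewrite (sum_class_prime _ p_pr px) inE /=; rewrite px in p_pr pB.
  by have [_ ->] := large_prime_sqsum p_pr pB.
have [p_pr|p_npr] := boolP (prime p).
  by rewrite sum_class_prime0 // => x px; apply: no; split=> //; exists x.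
by rewrite big1 // => r _; rewrite /class_prime (negPf p_npr).
Qed.

Section Symbol.

Variables (m : int) (e : nat).
Hypothesis m_alpha : m ^+ 2 = alpha ^+ 2.
Hypothesis trace_m : forall x, large_prime alpha D d x ->
  (trace_frob D (sqsum alpha x) == 2 * m) = (qsym alpha x D == e).
Hypothesis class_e : forall x (r : 'I_M), large_prime alpha D d x ->
  admissible alpha d r -> (x %% M)%N = r ->
  (r \in symbol_class alpha D d e) = (qsym alpha x D == e).

Lemma inQ_trace_classes p : (bound < p)%N ->
  [&& inQ m p, ~~ (p%:Z %| 2 * D)%Z & trace_frob D p == 2 * m]
  = (\sum_(r in symbol_class alpha D d e) class_prime r p)%N :> nat.
Proof.
move=> pB; rewrite (large_ndvd_2D D0 pB) /=.
have -> : inQ m p = inQ alpha p by rewrite /inQ m_alpha.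
case: inQP => [[p_pr [x px]]|no] /=.
  rewrite (sum_class_prime _ p_pr px); rewrite px in p_pr pB *.
  have [Px adm] := large_prime_sqsum p_pr pB.
  by rewrite trace_m // (class_e Px).
have [p_pr|p_npr] := boolP (prime p).
  by rewrite sum_class_prime0 // => x px; apply: no; split=> //; exists x.
by rewrite big1 // => r _; rewrite /class_prime (negPf p_npr).
Qed.

End Symbol.

End Counting.

Section Limits.

Variable R : realType.

Local Open Scope classical_set_scope.

Local Notation scale n := (Num.sqrt n%:R / ln n%:R : R).

Lemma scale_gt0 n : (2 <= n)%N -> 0 < scale n.
Proof.
by move=> n2; rewrite divr_gt0 ?sqrtr_gt0 ?ltr0n ?(ltnW n2) // ln_gt0 // ltr1n.
Qed.

(** The order of growth in the conjecture tends to infinity, so that finitely many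
    exceptional primes are negligible. *)
Lemma scale_inv_cvg0 : (fun n => (scale n)^-1) @ \oo --> (0 : R).
Proof.
apply/cvgrPdist_le => eps eps0; near=> n.
have n2 : (2 <= n)%N by near: n; exact: nbhs_infty_ge.
have big : (4 / eps) ^+ 4 < n%:R by near: n; exact: nbhs_infty_gtr.
have n0 : 0 < n%:R :> R by rewrite ltr0n ltnW.
pose t : R := Num.sqrt (Num.sqrt n%:R).
have t0 : 0 < t by rewrite !sqrtr_gt0.
have t2 : t ^+ 2 = Num.sqrt n%:R by rewrite sqr_sqrtr ?sqrtr_ge0.
have t4 : t ^+ 4 = n%:R by rewrite (exprM t 2 2) t2 sqr_sqrtr ?ltW.
have tbig : 4 / eps < t.
  rewrite -(ltr_pXn2r (_ : 0 < 4)%N) ?nnegrE ?ltW ?divr_gt0 //.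
  by rewrite t4.
(* the logarithm is at most four times the fourth root *)
have lnn : ln n%:R <= 4 * t.
  rewrite -t4 lnXn // -[ln t *+ 4]mulr_natl ler_wpM2l //; apply/ltW/ln_sublinear => //.
rewrite sub0r normrN ger0_norm ?invr_ge0 ?(ltW (scale_gt0 n2)) // invf_div -t2.
rewrite ler_pdivrMr ?exprn_gt0 //; apply: (le_trans lnn).
rewrite expr2 mulrA ler_pM2r //.
by move: tbig; rewrite ltr_pdivrMr // => /ltW; rewrite mulrC.
Unshelve. all: by end_near.
Qed.

Lemma eventually_eq_cvg (F G : nat -> nat) (B : nat) (l : R) :
  (forall p, (B < p)%N -> F p = G p) ->
  (fun n => (\sum_(0 <= p < n) G p)%N%:R / scale n) @ \oo --> l ->
  (fun n => (\sum_(0 <= p < n) F p)%N%:R / scale n) @ \oo --> l.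
Proof.
move=> FG hG.
pose C : R := (\sum_(0 <= p < B.+1) F p)%N%:R - (\sum_(0 <= p < B.+1) G p)%N%:R.
have : (fun n => (\sum_(0 <= p < n) G p)%N%:R / scale n + C * (scale n)^-1)
    @ \oo --> l + C * 0.
  by apply: cvgD => //; apply: cvgM; [exact: cvg_cst|exact: scale_inv_cvg0].
rewrite mulr0 addr0; apply: cvg_trans; apply: near_eq_cvg; near=> n.
have nB : (B.+1 <= n)%N by near: n; exact: nbhs_infty_ge.
rewrite -mulrDl; congr (_ / _).
rewrite (@big_cat_nat _ _ _ B.+1 0 n) //= [in RHS](@big_cat_nat _ _ _ B.+1 0 n) //=.
rewrite (eq_big_nat (m := B.+1) _ _ (F2 := G)); last by move=> i /andP[Bi _]; apply: FG.
by rewrite !natrD /C; ring.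
Unshelve. all: by end_near.
Qed.

End Limits.

(** * The densities *)

Section Density.

Variables (R : realType) (alpha D D' : int) (k : nat).
Hypotheses (hHL : Hardy_Littlewood R) (alpha1 : (4 %| alpha - 1)%Z) (D0 : D != 0).
Hypotheses (DE : D = 2 ^+ k * D') (D'_odd : odd `|D'|%N) (k_odd : odd k).

Local Open Scope classical_set_scope.

Let d := `|D'|%N.
Let M := (8 * d)%N.

Local Notation scale n := (Num.sqrt n%:R / ln n%:R : R).

Lemma cvg_sum_seq (I : Type) (s : seq I) (P : pred I) (f : I -> nat -> R) (l : I -> R) :
  (forall i, P i -> f i @ \oo --> l i) ->
  (fun n => \sum_(i <- s | P i) f i n) @ \oo --> \sum_(i <- s | P i) l i.
Proof.
move=> fl; elim: s => [|i s IH].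
  by under eq_fun do rewrite big_nil; rewrite big_nil; exact: cvg_cst.
under eq_fun do rewrite big_cons; rewrite big_cons.
by case: (boolP (P i)) => // Pi; apply: cvgD => //; exact: fl.
Qed.

Lemma class_count_cvg : exists2 delta : R, 0 < delta &
  forall r : nat, admissible alpha d r ->
    (fun n => (\sum_(0 <= p < n) class_prime alpha d r p)%N%:R / scale n)
      @ \oo --> delta.
Proof.
have alpha0 : alpha != 0 by apply/eqP=> a0; move: alpha1; rewrite a0.
have M_gt0 : (0 < M)%N := class_modulus_gt0 D'_odd.
have M_even : ~~ odd M by rewrite /M oddM.
have [delta delta0 H] := quad_primes_class alpha0 M_gt0 M_even hHL.
exists delta => // r /andP[r_even rd].
under eq_fun do rewrite -quad_primesE.
apply: H => //.
rewrite -[absz _]/(absz (r%:Z ^+ 2 + alpha ^+ 2)) addrC -/(sqsum alpha r).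
rewrite /M coprimeMr rd andbT (_ : 8 = 2 ^ 3)%N // coprime_pexpr // coprimen2.
rewrite sqsum_nat oddD !oddX /= (negPf r_even) addbF.
by case/dvdzP: alpha1 => a ea; lia.
Qed.

(** If all the primes of the class were small, their number divided by the order
    of growth would tend to 0 instead of [delta]. *)
Lemma admissible_populated r : (r < M)%N -> admissible alpha d r ->
  exists2 x, large_prime alpha D d x & (x %% M)%N = r.
Proof.
move=> rM adm; have [delta delta0 /(_ r adm) H] := class_count_cvg.
apply: contrapT => no.
have H0 : (fun n => (\sum_(0 <= p < n) class_prime alpha d r p)%N%:R / scale n)
    @ \oo --> (0 : R).
  apply: (@eventually_eq_cvg _ _ (fun=> 0%N) (maxn M (absz (2 * D)))) => [p pB|].
    apply/eqP; rewrite eqb0; apply/class_primeP => -[p_pr [x px]].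
    rewrite px in p_pr pB; have [Px _] := large_prime_sqsum alpha1 D'_odd D0 p_pr pB.
    by apply: no; exists (M * x + r)%N => //; rewrite mulnC modnMDl modn_small.
  under eq_fun do rewrite big1_eq mul0r; exact: cvg_cst.
have := cvg_unique _ H H0 => /(_ (@norm_hausdorff _ _)) e.
by move: delta0; rewrite e ltxx.
Qed.

Lemma class_set_cvg (delta : R) (A : {set 'I_M}) :
  (forall r : nat, admissible alpha d r ->
    (fun n => (\sum_(0 <= p < n) class_prime alpha d r p)%N%:R / scale n)
      @ \oo --> delta) ->
  A \subset admissible_set alpha d ->
  (fun n => (\sum_(0 <= p < n) \sum_(r in A) class_prime alpha d r p)%N%:R / scale n)
    @ \oo --> #|A|%:R * delta.
Proof.
move=> H /fintype.subsetP AS.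
have -> : #|A|%:R * delta = \sum_(r in A) delta by rewrite sumr_const mulr_natl.
under eq_fun do rewrite exchange_big /= natr_sum mulr_suml.
apply: cvg_sum_seq => r /AS; rewrite inE; exact: H.
Qed.

Lemma dens_seq_cvg (m : int) (e : nat) : (e < 4)%N -> m ^+ 2 = alpha ^+ 2 ->
  (forall x, large_prime alpha D d x ->
    (trace_frob D (sqsum alpha x) == 2 * m) = (qsym alpha x D == e)) ->
  dens_seq R D m @ \oo --> (1 / 4 : R).
Proof.
move=> e4 m_alpha trace_m.
have [u u_odd shift] := qsym_shift alpha1 DE D'_odd k_odd.
have [delta delta0 H] := class_count_cvg.
have class_e x (r : 'I_M) : large_prime alpha D d x -> admissible alpha d r ->
    (x %% M)%N = r -> (r \in symbol_class alpha D d e) = (qsym alpha x D == e).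
  exact: (symbol_classP D0 shift).
have cardE : #|admissible_set alpha d| = (4 * #|symbol_class alpha D d e|)%N.
  exact: card_admissible alpha1 D'_odd D0 u_odd shift admissible_populated _ e4.
set S := symbol_class alpha D d e in class_e cardE.
have SA : S \subset admissible_set alpha d.
  by apply/fintype.subsetP => r; rewrite !inE => /andP[].
pose B := maxn M (absz (2 * D)).
pose T : pred nat := fun p => [&& inQ m p, ~~ (p%:Z %| 2 * D)%Z & trace_frob D p == 2 * m].
have hT : (fun n => (\sum_(0 <= p < n) T p)%N%:R / scale n) @ \oo --> #|S|%:R * delta.
  apply: (eventually_eq_cvg (B := B)) (class_set_cvg H SA) => p pB.
  exact: (inQ_trace_classes alpha1 D'_odd D0 m_alpha trace_m class_e).
have hQ : (fun n => (\sum_(0 <= p < n) inQ m p)%N%:R / scale n) @ \oo -->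
    (4 * #|S|)%N%:R * delta.
  rewrite -cardE.
  apply: (eventually_eq_cvg (B := B)) (class_set_cvg H (fintype.subxx _)) => p pB.
  by rewrite -(inQ_classes alpha1 D'_odd D0 pB) /inQ m_alpha.
have S0 : (0 < #|S|)%N.
  have [r adm] := ex_admissible alpha1 D'_odd.
  have : (0 < #|admissible_set alpha d|)%N.
    by apply/card_gt0P; exists r; rewrite inE.
  by rewrite cardE muln_gt0.
have Sd : #|S|%:R * delta != 0 by rewrite mulf_neq0 ?pnatr_eq0 -?lt0n // gt_eqF.
have S4d : (4 * #|S|)%N%:R * delta != 0.
  by rewrite mulf_neq0 ?pnatr_eq0 ?muln_eq0 -?lt0n // gt_eqF.
have -> : 1 / 4 = #|S|%:R * delta / ((4 * #|S|)%N%:R * delta) :> R.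
  by rewrite natrM; field; rewrite gt_eqF //= gt_eqF ?ltr0n.
have hTQ : (fun n => (\sum_(0 <= p < n) T p)%N%:R / scale n /
    ((\sum_(0 <= p < n) inQ m p)%N%:R / scale n)) @ \oo -->
    #|S|%:R * delta / ((4 * #|S|)%N%:R * delta).
  by apply: cvgM => //; apply: cvgV.
rewrite -cvg_shiftS in hTQ; apply: cvg_trans hTQ; apply: near_eq_cvg; near=> n.
have n2 : (2 <= n)%N by near: n; exact: nbhs_infty_ge.
have s0 : scale n.+1 != 0 by rewrite gt_eqF // scale_gt0 // leqW.
rewrite /dens_seq /cardQ_trace /cardQ (card_pred_ord (inQ m)) (card_pred_ord T) /=.
by move: (scale n.+1) s0 => t s0; rewrite invf_div mulrA mulfVK.
Unshelve. all: by end_near.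
Qed.

End Density.

Local Open Scope classical_set_scope.
Local Open Scope ring_scope.

Theorem theorem3p9 (R : realType) (hHL : Hardy_Littlewood R)
    (alpha D : int) (halpha : (alpha = 1 %[mod 4])%Z) (hD0 : D != 0)
    (hD : exactly_divides 2 1 D \/ exactly_divides 2 3 D) :
  dens_seq R D alpha @ \oo --> (1 / 4 : R) /\
  dens_seq R D (- alpha) @ \oo --> (1 / 4 : R).
Proof.
have alpha1 : (4 %| alpha - 1)%Z by rewrite -eqz_mod_dvd; apply/eqP.
have [k [k_odd [D' DE D'_odd]]] : exists k, odd k /\
    exists2 D' : int, D = 2 ^+ k * D' & odd `|D'|%N.
  by case: hD => /exactly_divides_odd_part ?; [exists 1%N|exists 3%N].
split.
- apply: (dens_seq_cvg hHL alpha1 hD0 DE D'_odd k_odd (e := 0)) => // x Px.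
  by apply: trace_frob_eq_alpha => //; [apply: large_prime_two_square Px|apply: large_prime_ndvd Px].
- apply: (dens_seq_cvg hHL alpha1 hD0 DE D'_odd k_odd (e := 2)) => //.
    by rewrite sqrrN.
  move=> x Px.
  by apply: trace_frob_eqN_alpha => //; [apply: large_prime_two_square Px|apply: large_prime_ndvd Px].
Qed.
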